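(* Consider the family of discrete dynamical systems $F_\lambda:\mathbb{R}^2\to\mathbb{R}^2$, $\lambda\in\mathbb{R}$, $$F_\lambda\begin{pmatrix} x \\ y \end{pmatrix}=\begin{pmatrix} -1 & 0 \\ 0 & -2 \end{pmatrix}\begin{pmatrix} x \\ y \end{pmatrix}+\begin{pmatrix} g_c(\lambda,x,y) \\ g_u(\lambda,x,y) \end{pmatrix},$$ $$g_c(\lambda,x,y)=-\big((x+y)^3-3(x+y)^2-\lambda(x+y)\big),\qquad g_u(\lambda,x,y)=2\big((x+y)^3-3(x+y)^2-\lambda(x+y)\big).$$ i) The dynamical system undergoes a period doubling bifurcation at the origin for $\lambda=0$. ii) For $0<\lambda\le 7.6\cdot10^{-5}$, the $2$-periodic orbit of $F_\lambda$ (that is, the one created in this bifurcation, which exists for these $\lambda$) lies inside the box $\mathcal{B}_\lambda$ defined in the context, where $\mathcal{E}_R=57.1\sqrt\lambda$ and $\mathcal{E}_K=61.9\sqrt\lambda$. Furthermore, there exists a one-dimensional manifold inside $\mathcal{B}_\lambda$ consisting of heteroclinic connections of $F_\lambda$ between the origin and the periodic orbit.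
   Context: For $\lambda\ge0$ and $\mathcal{E}_R,\mathcal{E}_K\ge0$, the box is $\mathcal{B}_\lambda=[\lambda_{c,-},\lambda_{c,+}]\times[\lambda_{u,-},\lambda_{u,+}]$ with $$\lambda_{c,\pm}=\pm\tfrac12\sqrt{1+\mathcal{E}_R}\sqrt\lambda+\tfrac{3(1+\mathcal{E}_R)\lambda}{8},$$ $$\lambda_{u,-}=-\tfrac{\lambda}{2}\Big(1+\mathcal{E}_R+2\mathcal{E}_R\sqrt{(1+\mathcal{E}_R)\lambda}+2\mathcal{E}_K\sqrt{(1+\mathcal{E}_R)\lambda}\Big),$$ $$\lambda_{u,+}=\tfrac{1}{216}\big(\sqrt{1+12\lambda+12\mathcal{E}_K\lambda}-1\big)^2\big(2\sqrt{1+12\lambda+12\mathcal{E}_K\lambda}+1\big).$$ The origin is a fixed point of $F_\lambda$ for every $\lambda$. A heteroclinic connection between the origin and the periodic orbit is an orbit of $F_\lambda$ that converges to one of them in forward time and to the other in backward time. *)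

(* Defs.v *)
From Stdlib Require Import Reals ZArith.
From Coquelicot Require Import Coquelicot.
Open Scope R_scope.

(** * The family of maps and the box *)

Definition g_c (lam x y : R) : R :=
  - ((x + y) ^ 3 - 3 * (x + y) ^ 2 - lam * (x + y)).

Definition g_u (lam x y : R) : R :=
  2 * ((x + y) ^ 3 - 3 * (x + y) ^ 2 - lam * (x + y)).

Definition F (lam : R) (z : R * R) : R * R :=
  (- 1 * fst z + 0 * snd z + g_c lam (fst z) (snd z),
   0 * fst z + - 2 * snd z + g_u lam (fst z) (snd z)).

Definition lam_c_minus (lam ER : R) : R :=
  - (1 / 2 * sqrt (1 + ER) * sqrt lam) + 3 * (1 + ER) * lam / 8.

Definition lam_c_plus (lam ER : R) : R :=
  1 / 2 * sqrt (1 + ER) * sqrt lam + 3 * (1 + ER) * lam / 8.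

Definition lam_u_minus (lam ER EK : R) : R :=
  - (lam / 2) * (1 + ER + 2 * ER * sqrt ((1 + ER) * lam)
                 + 2 * EK * sqrt ((1 + ER) * lam)).

Definition lam_u_plus (lam EK : R) : R :=
  1 / 216 * (sqrt (1 + 12 * lam + 12 * EK * lam) - 1) ^ 2
  * (2 * sqrt (1 + 12 * lam + 12 * EK * lam) + 1).

Definition box (lam ER EK : R) (z : R * R) : Prop :=
  (lam_c_minus lam ER <= fst z <= lam_c_plus lam ER) /\
  (lam_u_minus lam ER EK <= snd z <= lam_u_plus lam EK).

(** * Smooth functions and curves on an open interval *)

Definition smooth (a b : R) (f : R -> R) : Prop :=
  forall (n : nat) (t : R), a < t < b -> ex_derive_n f n t.

Definition smooth_curve (a b : R) (c : R -> R * R) : Prop :=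
  smooth a b (fun t => fst (c t)) /\ smooth a b (fun t => snd (c t)).

Definition velocity (c : R -> R * R) (t : R) : R * R :=
  (Derive (fun s => fst (c s)) t, Derive (fun s => snd (c s)) t).

(** Embedded smooth one-dimensional submanifold of the plane: every point of
    [M] has an open neighbourhood [V] such that [M] inside [V] is the image of
    an open interval under a smooth regular curve [c] that is a homeomorphism
    onto its image, with continuous inverse [chart]. *)
Definition one_dim_manifold (M : R * R -> Prop) : Prop :=
  forall z : R * R, M z ->
  exists (V : R * R -> Prop) (a b : R) (c : R -> R * R) (chart : R * R -> R),
    open V /\ V z /\
    smooth_curve a b c /\
    (forall t, a < t < b -> velocity c t <> (0, 0)) /\
    (forall t, a < t < b -> M (c t) /\ V (c t) /\ chart (c t) = t) /\
    (forall w, M w -> V w ->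
       a < chart w < b /\ c (chart w) = w /\
       filterlim chart (within (fun w' => M w' /\ V w') (locally w))
         (locally (chart w))).

(** * Linearization *)

(** [mu] is an eigenvalue of the complexification of the real linear map [A]:
    [v + i w] is a nonzero complex eigenvector. *)
Definition eigenvalue (A : R * R -> R * R) (mu : C) : Prop :=
  exists v w : R * R,
    ~ (v = (0, 0) /\ w = (0, 0)) /\
    A v = minus (scal (Re mu) v) (scal (Im mu) w) /\
    A w = plus (scal (Re mu) w) (scal (Im mu) v).

Definition derivative_at (f : R * R -> R * R) (p : R * R)
    (A : R * R -> R * R) : Prop :=
  filterdiff f (locally p) A.

Definition hyperbolic_fixed_point (f : R * R -> R * R) (p : R * R) : Prop :=
  f p = p /\
  exists A, derivative_at f p A /\
            forall mu : C, eigenvalue A mu -> Cmod mu <> 1.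

(** * Period doubling *)

Definition period_two (f : R * R -> R * R) (z : R * R) : Prop :=
  f (f z) = z /\ f z <> z.

Definition orbit_of_two (f : R * R -> R * R) (z w : R * R) : Prop :=
  w = z \/ w = f z.

(** Period doubling (flip) bifurcation of a family of planar maps, as in
    Guckenheimer and Holmes, Theorem 3.5.1:
    - the fixed point [p0] at parameter [l0] has eigenvalue [-1], which is
      simple and the only eigenvalue on the unit circle (in the plane: the
      other eigenvalue [nu] has [|nu| <> 1]);
    - [p0] lies on a smooth curve [p] of fixed points, along which the
      eigenvalue [mu] crosses [-1] with nonzero speed;
    - through [(l0, p0)] passes a smooth curve [t |-> (L t, q t)], quadratically
      tangent to the plane [l = l0], which away from [t = 0] consists of
      hyperbolic points of minimal period two, and which contains all points of
      minimal period two close to [(l0, p0)]. *)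
Definition period_doubling (G : R -> R * R -> R * R) (l0 : R) (p0 : R * R)
    : Prop :=
  (exists (A : R * R -> R * R) (nu : R),
     derivative_at (G l0) p0 A /\
     eigenvalue A (RtoC (-1)) /\ eigenvalue A (RtoC nu) /\ Rabs nu <> 1) /\
  (exists (d : R) (p : R -> R * R) (A : R -> R * R -> R * R) (mu : R -> R)
          (mu' : R),
     0 < d /\ smooth_curve (l0 - d) (l0 + d) p /\ p l0 = p0 /\
     (forall l, l0 - d < l < l0 + d ->
        G l (p l) = p l /\ derivative_at (G l) (p l) (A l) /\
        eigenvalue (A l) (RtoC (mu l))) /\
     mu l0 = -1 /\ is_derive mu l0 mu' /\ mu' <> 0) /\
  (exists (d : R) (L : R -> R) (q : R -> R * R),
     0 < d /\ smooth (- d) d L /\ smooth_curve (- d) d q /\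
     L 0 = l0 /\ q 0 = p0 /\
     velocity q 0 <> (0, 0) /\ Derive L 0 = 0 /\ Derive_n L 2 0 <> 0 /\
     (forall t, - d < t < d -> t <> 0 ->
        period_two (G (L t)) (q t) /\
        hyperbolic_fixed_point (fun z => G (L t) (G (L t) z)) (q t)) /\
     (exists eps : R, 0 < eps /\
        forall (l : R) (z : R * R),
          ball l0 eps l -> ball p0 eps z -> period_two (G l) z ->
          exists t, - d < t < d /\ l = L t /\ z = q t)).

(** [q] follows, for parameters up to [l1], the two-periodic orbit emanating
    from [p0] at [l0]: a continuous family starting at [p0], of points of
    minimal period two for [l0 < l <= l1].  At a period doubling bifurcation
    the last clause of [period_doubling] forces [q l] to be on the bifurcating
    curve for [l] close to [l0]. *)
Definition bifurcating_orbit (G : R -> R * R -> R * R) (l0 : R) (p0 : R * R)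
    (l1 : R) (q : R -> R * R) : Prop :=
  q l0 = p0 /\
  (forall l, l0 <= l <= l1 ->
     filterlim q (within (fun l' => l0 <= l' <= l1) (locally l))
       (locally (q l))) /\
  (forall l, l0 < l <= l1 -> period_two (G l) (q l)).

(** * Heteroclinic connections *)

Definition converges_to_set (u : nat -> R * R) (S : R * R -> Prop) : Prop :=
  forall eps : R, 0 < eps ->
    eventually (fun n => exists w, S w /\ ball w eps (u n)).

Definition full_orbit (f : R * R -> R * R) (u : Z -> R * R) : Prop :=
  forall n : Z, u (n + 1)%Z = f (u n).

Definition heteroclinic (f : R * R -> R * R) (S T : R * R -> Prop)
    (u : Z -> R * R) : Prop :=
  full_orbit f u /\
  ((converges_to_set (fun n => u (Z.of_nat n)) S /\
    converges_to_set (fun n => u (- Z.of_nat n)%Z) T) \/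
   (converges_to_set (fun n => u (Z.of_nat n)) T /\
    converges_to_set (fun n => u (- Z.of_nat n)%Z) S)).

(* Main.v *)
Require Import Defs.
From Stdlib Require Import Reals ZArith Lra Lia Psatz Wf_nat Classical_Prop.
From Coquelicot Require Import Coquelicot.
Open Scope R_scope.

(**
The sum [s = x + y] of the coordinates obeys, along every orbit, the recurrence
[s (n+1) + 3 s n + 2 s (n-1) = cubic lam (s n)], because [2 x + y] is sent to
[- 2 (x + y)] ([F_state]). Everything is proved in these terms.

A point of minimal period two is a pair [(a, b)] with
[cubic lam a = cubic lam b = 3 (a + b)]. Eliminating the difference gives a cubic
equation for [a + b] with a single real root, so that for each small positive
[lam] there is exactly one two-periodic orbit ([two_cycle_unique]). With
[a + b = - t ^ 2] both [lam] and [a - b] become smooth functions of [t]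
([curve_lam], [curve_gap]), which is the bifurcating curve; its points are
hyperbolic because the trace of the second iterate differs from its critical value
by about [12 (a - b) ^ 2] ([hyperbolic_two_cycle]).

For [lam > 0] the origin is a saddle with a stable multiplier [- / r] slightly
larger than [-1]. Its stable manifold is parametrized by an entire function: a
power series [s] with
[s (- t / r) + 3 s t + 2 s (- r t) = cubic lam (s t)] can be computed coefficient by
coefficient, the divisors growing geometrically ([stable_series],
[stable_manifold_function]). Forward in time [t] is multiplied by [- / r], hence all
points of this curve tend to the origin.

Backward in time the map preserves a cone of directions close to [s (n-1) = - s n]
([cone_step]), as long as [s] is small, and is therefore monotone, up to a sign, for
the order which this cone defines ([cone_order_step]). Near the origin the curve lies
between the origin and the two points of the cycle; by monotonicity it always does,
and its parametrization is strictly increasing ([branch_invariants]). So [s] has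
limits at both ends. They form a two-cycle, and there is only one
([connecting_branch_exists]). The curve without the origin is thus an embedded
curve consisting of connecting orbits.

The order interval also gives the horizontal bounds of the box. The vertical ones
are finer, since the upper bound is only of size [lam ^ 2 / 2]: the curve stays close
to the parabola [y = - 2 s ^ 2 - 2 lam s], because the deviation from it is halved at
each backward step, up to terms of third order ([near_graph_step]). The maximum of
that parabola is [lam ^ 2 / 2] and its value at the cycle about [- lam / 2]; the
relative errors are of order [sqrt lam] and fit into the margins of the box
([height_bound]).
*)

(** * The map as a second-order recurrence *)

Definition cubic (lam s : R) : R := s ^ 3 - 3 * s ^ 2 - lam * s.

(** Coordinates that turn the map into a scalar recurrence: along an orbit,
    [u] is the current value of [x + y] and [v] the preceding one. *)
Definition state (u v : R) : R * R := (- 2 * v - u, 2 * u + 2 * v).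

(** Since [2 x + y] is sent to [- 2 (x + y)], the orbits of [F lam] are the
    solutions of [s (n+1) + 3 s n + 2 s (n-1) = cubic lam (s n)]; in particular
    [F lam] is invertible and halves areas backward in time. *)
Lemma F_state (lam u v : R) :
  F lam (state u v) = state (cubic lam u - 3 * u - 2 * v) u.
Proof.
  unfold F, state, g_c, g_u, cubic; simpl; f_equal; ring.
Qed.

Lemma state_surj (z : R * R) : z = state (fst z + snd z) (- fst z - snd z / 2).
Proof. destruct z as [x y]; unfold state; simpl; f_equal; field. Qed.

Lemma state_inj (u v u' v' : R) : state u v = state u' v' -> u = u' /\ v = v'.
Proof. intros H; injection H; intros; split; lra. Qed.

(** The relation of the recurrence on an alternating sequence a, b, a, b. *)
Definition two_cycle (lam a b : R) : Prop :=
  a <> b /\ cubic lam a = 3 * (a + b) /\ cubic lam b = 3 * (a + b).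

Lemma period_two_state (lam u v : R) :
  period_two (F lam) (state u v) <-> two_cycle lam u v.
Proof.
  unfold period_two, two_cycle; rewrite !F_state; split.
  - intros [H1 H2]; apply state_inj in H1; destruct H1 as [H3 H4].
    rewrite H4 in H3.
    repeat split; try lra.
    intros E; apply H2; rewrite H4, E; reflexivity.
  - intros (Hn & H1 & H2).
    replace (cubic lam u - 3 * u - 2 * v) with v by lra.
    split; [f_equal; lra|].
    intros E; apply state_inj in E; lra.
Qed.

Lemma two_cycle_sym (lam a b : R) : two_cycle lam a b -> two_cycle lam b a.
Proof. intros (H1 & H2 & H3); repeat split; [auto|lra|lra]. Qed.

(** Subtracting the two equations and cancelling [a - b] expresses [lam]
    through the symmetric functions of [a] and [b]; their sum then yields a
    cubic equation for [a + b] alone. *)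
Lemma two_cycle_sum (lam a b : R) :
  two_cycle lam a b ->
  lam * (a + b - 3) = (a + b) ^ 3 - 6 * (a + b) ^ 2 + 12 * (a + b) /\
  (a - b) ^ 2 = - 3 * (a + b) ^ 2 + 12 * (a + b) + 4 * lam.
Proof.
  intros (Hn & Ha & Hb); unfold cubic in *.
  assert (Hq : a ^ 2 + a * b + b ^ 2 - 3 * (a + b) - lam = 0).
  { apply Rmult_eq_reg_l with (a - b); [|lra].
    replace ((a - b) * (a ^ 2 + a * b + b ^ 2 - 3 * (a + b) - lam))
      with ((a ^ 3 - 3 * a ^ 2 - lam * a) - (b ^ 3 - 3 * b ^ 2 - lam * b)) by ring.
    lra. }
  assert (Hl : lam = a ^ 2 + a * b + b ^ 2 - 3 * (a + b)) by lra.
  rewrite Hl in *.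
  split; nra.
Qed.

(** The difference of the cubic equations for two sums [S] and [S'] is
    [S - S'] times a quadratic expression, which is positive because [S] is far
    from 2 and [lam] at most 1: for given [lam] there is only one sum, hence one
    pair. This is why every continuous family of two-periodic points is the
    bifurcating one. *)
Lemma two_cycle_unique (lam a b a' b' : R) :
  lam <= 1 -> a + b <= 0 -> two_cycle lam a b -> two_cycle lam a' b' ->
  (a' = a /\ b' = b) \/ (a' = b /\ b' = a).
Proof.
  intros Hl Hs H H'.
  apply two_cycle_sum in H; apply two_cycle_sum in H'.
  destruct H as [H1 H2], H' as [H1' H2'].
  assert (E : a' + b' = a + b).
  { set (S := a + b) in *; set (S' := a' + b') in *.
    assert (H : (S - S') * ((S / 2 + S' - 3) ^ 2 + 3 / 4 * (S - 2) ^ 2 - lam) = 0)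
      by nra.
    apply Rmult_integral in H; destruct H as [H|H]; [lra|].
    assert (0 <= (S / 2 + S' - 3) ^ 2) by apply pow2_ge_0. nra. }
  rewrite E in H2'.
  assert (Hd : (a' - b' - (a - b)) * (a' - b' + (a - b)) = 0) by nra.
  apply Rmult_integral in Hd; destruct Hd; [left|right]; split; lra.
Qed.

(** Here [v = - (a + b)] and [d = a - b]; the first hypothesis is the cubic
    equation for the sum, the second one the discriminant of the pair. *)
Lemma two_cycle_param (lam v d : R) :
  lam * (v + 3) = v ^ 3 + 6 * v ^ 2 + 12 * v ->
  d ^ 2 = 4 * lam - 3 * v ^ 2 - 12 * v -> d <> 0 ->
  two_cycle lam ((- v + d) / 2) ((- v - d) / 2).
Proof.
  intros H Hd Hd0.
  assert (E : lam = (d ^ 2 + 3 * v ^ 2 + 12 * v) / 4) by lra.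
  unfold two_cycle, cubic; repeat split.
  - lra.
  - apply Rminus_diag_uniq.
    transitivity (v ^ 3 + 6 * v ^ 2 + 12 * v - lam * (v + 3));
      [rewrite E; field | lra].
  - apply Rminus_diag_uniq.
    transitivity (v ^ 3 + 6 * v ^ 2 + 12 * v - lam * (v + 3));
      [rewrite E; field | lra].
Qed.

(** Informative existence, so that the roots can be made a function of [lam]. *)
Lemma ex_sum_root (lam : R) :
  0 <= lam ->
  { v | 0 <= v /\ lam * (v + 3) = v ^ 3 + 6 * v ^ 2 + 12 * v }.
Proof.
  intros Hl.
  set (f := fun v => v ^ 3 + 6 * v ^ 2 + 12 * v - lam * (v + 3)).
  destruct (IVT_cor f 0 lam) as [v [Hv Hf]].
  - unfold f; intros x; apply continuity_pt_filterlim.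
    apply (ex_derive_continuous (fun v => v ^ 3 + 6 * v ^ 2 + 12 * v - lam * (v + 3))).
    auto_derive; trivial.
  - exact Hl.
  - unfold f.
    assert (0 <= lam * (lam ^ 3 + 6 * lam ^ 2 + 12 * lam - lam * (lam + 3))); [|nra].
    replace (lam * (lam ^ 3 + 6 * lam ^ 2 + 12 * lam - lam * (lam + 3)))
      with (lam ^ 2 * (lam ^ 2 + 5 * lam + 9)) by ring.
    apply Rmult_le_pos; [apply pow2_ge_0|nra].
  - exists v; unfold f in Hf; lra.
Qed.

(** * Infinite differentiability of elementary expressions *)

(** A class of expressions closed under differentiation: being defined at every
    point of an interval is inherited by the derivative, which gives derivatives
    of all orders at once. *)
Inductive term : Type :=
| TVar : term
| TCst : R -> term
| TAdd : term -> term -> term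
| TMul : term -> term -> term
| TInv : term -> term
| TSqrt : term -> term.

Fixpoint teval (e : term) (t : R) : R :=
  match e with
  | TVar => t
  | TCst c => c
  | TAdd e1 e2 => teval e1 t + teval e2 t
  | TMul e1 e2 => teval e1 t * teval e2 t
  | TInv e1 => / teval e1 t
  | TSqrt e1 => sqrt (teval e1 t)
  end.

Fixpoint tdef (e : term) (t : R) : Prop :=
  match e with
  | TVar | TCst _ => True
  | TAdd e1 e2 | TMul e1 e2 => tdef e1 t /\ tdef e2 t
  | TInv e1 => tdef e1 t /\ teval e1 t <> 0
  | TSqrt e1 => tdef e1 t /\ 0 < teval e1 t
  end.

Fixpoint tderive (e : term) : term :=
  match e with
  | TVar => TCst 1
  | TCst _ => TCst 0
  | TAdd e1 e2 => TAdd (tderive e1) (tderive e2)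
  | TMul e1 e2 => TAdd (TMul (tderive e1) e2) (TMul e1 (tderive e2))
  | TInv e1 => TMul (TCst (- 1)) (TMul (tderive e1) (TMul (TInv e1) (TInv e1)))
  | TSqrt e1 => TMul (tderive e1) (TInv (TMul (TCst 2) (TSqrt e1)))
  end.

Lemma tderive_correct (e : term) (t : R) :
  tdef e t -> tdef (tderive e) t /\ is_derive (teval e) t (teval (tderive e) t).
Proof.
  induction e as [|c|e1 IH1 e2 IH2|e1 IH1 e2 IH2|e1 IH1|e1 IH1]; simpl.
  - intros _; split; [exact I|exact (is_derive_id (K := R_AbsRing) t)].
  - intros _; split; [exact I|exact (is_derive_const (K := R_AbsRing) c t)].
  - intros [H1 H2]; destruct (IH1 H1), (IH2 H2); split; [tauto|].
    apply (is_derive_plus (teval e1) (teval e2)); assumption.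
  - intros [H1 H2]; destruct (IH1 H1), (IH2 H2); split; [tauto|].
    apply (is_derive_mult (teval e1) (teval e2)); auto.
    intros; apply Rmult_comm.
  - intros [H1 H0]; destruct (IH1 H1); split; [tauto|].
    replace (-1 * (teval (tderive e1) t * (/ teval e1 t * / teval e1 t)))
      with (- teval (tderive e1) t / teval e1 t ^ 2) by (field; exact H0).
    apply is_derive_inv; assumption.
  - intros [H1 H0]; destruct (IH1 H1) as [H2 H3].
    assert (Hs : 0 < sqrt (teval e1 t)) by (apply sqrt_lt_R0, H0).
    split; [repeat split; auto; lra|].
    replace (teval (tderive e1) t * / (2 * sqrt (teval e1 t)))
      with (teval (tderive e1) t / (2 * sqrt (teval e1 t))) by reflexivity.
    apply (is_derive_sqrt (teval e1)); assumption.
Qed.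

(** The iterated derivative is again the value of an expression, and this on
    the whole interval, so that it may be differentiated once more. *)
Lemma Derive_n_teval (a b : R) (n : nat) (e : term) :
  (forall t, a < t < b -> tdef e t) ->
  forall t, a < t < b ->
    ex_derive_n (teval e) n t /\ tdef (Nat.iter n tderive e) t /\
    Derive_n (teval e) n t = teval (Nat.iter n tderive e) t.
Proof.
  intros He; induction n as [|n IH]; intros t Ht.
  - simpl; auto.
  - assert (Hloc : locally t (fun u => teval (Nat.iter n tderive e) u
                                       = Derive_n (teval e) n u)).
    { apply (locally_interval _ t a b); simpl; try tauto.
      intros u Hu1 Hu2; symmetry; apply IH; simpl in *; lra. }
    destruct (IH t Ht) as (_ & Hd & _).
    apply tderive_correct in Hd; destruct Hd as [Hd Hder].
    assert (H := is_derive_ext_loc _ _ _ _ Hloc Hder).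
    split; [|split; [exact Hd|]].
    + eexists; exact H.
    + apply is_derive_unique, H.
Qed.

Lemma smooth_term (a b : R) (e : term) (f : R -> R) :
  (forall t, f t = teval e t) -> (forall t, a < t < b -> tdef e t) ->
  smooth a b f.
Proof.
  intros Hf He n t Ht.
  apply ex_derive_n_ext with (teval e); [intros; symmetry; apply Hf|].
  apply (Derive_n_teval a b n e He t Ht).
Qed.

(** * The curve of two-cycles *)

(** The parameter as a function of [t], where [t ^ 2 = - (a + b)]: the solution
    [lam] of the cubic equation for the sum. *)
Definition curve_lam (t : R) : R :=
  (t ^ 6 + 6 * t ^ 4 + 12 * t ^ 2) / (t ^ 2 + 3).

(** The difference [a - b]. With the sum equal to [- t ^ 2] its square is
    [t ^ 2] times a positive function, so that the square root can be extracted
    smoothly through [t = 0]; this is the reason for the choice of [t]. *)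
Definition curve_gap (t : R) : R :=
  t * sqrt ((t ^ 4 + 3 * t ^ 2 + 12) / (t ^ 2 + 3)).

Definition curve_point (t : R) : R * R :=
  state ((- t ^ 2 + curve_gap t) / 2) ((- t ^ 2 - curve_gap t) / 2).

Lemma curve_radicand_pos (t : R) : 0 < (t ^ 4 + 3 * t ^ 2 + 12) / (t ^ 2 + 3).
Proof.
  assert (0 <= t ^ 2) by apply pow2_ge_0.
  assert (0 <= t ^ 4) by (replace (t ^ 4) with ((t ^ 2) ^ 2) by ring; apply pow2_ge_0).
  apply Rdiv_lt_0_compat; lra.
Qed.

Lemma curve_gap_neq0 (t : R) : t <> 0 -> curve_gap t <> 0.
Proof.
  intros Ht; apply Rmult_integral_contrapositive_currified; [exact Ht|].
  apply Rgt_not_eq, sqrt_lt_R0, curve_radicand_pos.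
Qed.

Lemma curve_lam_eq (t : R) :
  curve_lam t * (t ^ 2 + 3) = (t ^ 2) ^ 3 + 6 * (t ^ 2) ^ 2 + 12 * t ^ 2.
Proof.
  assert (0 <= t ^ 2) by apply pow2_ge_0.
  unfold curve_lam; field; lra.
Qed.

Lemma curve_gap_sqr (t : R) :
  curve_gap t ^ 2 = 4 * curve_lam t - 3 * (t ^ 2) ^ 2 - 12 * t ^ 2.
Proof.
  assert (0 <= t ^ 2) by apply pow2_ge_0.
  unfold curve_gap; rewrite Rpow_mult_distr, pow2_sqrt
    by (apply Rlt_le, curve_radicand_pos).
  unfold curve_lam; field; lra.
Qed.

Lemma curve_two_cycle (t : R) :
  t <> 0 ->
  two_cycle (curve_lam t)
    ((- t ^ 2 + curve_gap t) / 2) ((- t ^ 2 - curve_gap t) / 2).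
Proof.
  intros Ht; apply two_cycle_param;
    [apply curve_lam_eq | apply curve_gap_sqr | apply curve_gap_neq0, Ht].
Qed.

(** The square of [u - v] is positive, which forces [u + v] to be negative;
    the sign of [t] is chosen as that of [u - v], since [t] and [- t] describe the
    two points of one orbit. *)
Lemma two_cycle_on_curve (lam u v : R) :
  u + v < 3 -> two_cycle lam u v ->
  exists t, t ^ 2 = - (u + v) /\ lam = curve_lam t /\ state u v = curve_point t.
Proof.
  intros Hs H.
  assert (Hn := proj1 H); apply two_cycle_sum in H; destruct H as [H1 H2].
  set (x := - (u + v)).
  assert (Hg : (u - v) ^ 2 * (x + 3) = x * (x ^ 2 + 3 * x + 12))
    by (unfold x in *; nra).
  assert (Hgap : 0 < (u - v) ^ 2) by (apply pow2_gt_0; lra).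
  assert (Hx : 0 < x).
  { destruct (Rlt_or_le 0 x) as [|Hx]; [assumption|exfalso].
    assert (0 < (u - v) ^ 2 * (x + 3)) by (apply Rmult_lt_0_compat; unfold x; lra).
    assert (0 <= (x + 3 / 2) ^ 2) by apply pow2_ge_0.
    assert (0 <= - x * (x ^ 2 + 3 * x + 12)) by (apply Rmult_le_pos; lra).
    lra. }
  assert (Ht : exists t, t ^ 2 = x /\ 0 < t * (u - v)).
  { assert (Hsx : 0 < sqrt x) by (apply sqrt_lt_R0, Hx).
    assert (Hsx2 : sqrt x ^ 2 = x) by (apply pow2_sqrt; lra).
    destruct (Rlt_or_le 0 (u - v)) as [Huv|Huv].
    - exists (sqrt x); split; [exact Hsx2|apply Rmult_lt_0_compat; assumption].
    - exists (- sqrt x); split; [transitivity (sqrt x ^ 2); [ring|exact Hsx2]|].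
      replace (- sqrt x * (u - v)) with (sqrt x * (v - u)) by ring.
      apply Rmult_lt_0_compat; lra. }
  destruct Ht as (t & Ht & Hpos); exists t.
  split; [exact Ht|].
  assert (El : lam = curve_lam t).
  { apply Rmult_eq_reg_r with (t ^ 2 + 3); [|lra].
    rewrite curve_lam_eq, Ht; unfold x; lra. }
  split; [exact El|].
  assert (Hd2 : (u - v) ^ 2 = curve_gap t ^ 2).
  { rewrite curve_gap_sqr, <- El, Ht, H2; unfold x; ring. }
  assert (Hgp : 0 <= t * curve_gap t).
  { unfold curve_gap; replace (t * (t * sqrt _))
      with (t ^ 2 * sqrt ((t ^ 4 + 3 * t ^ 2 + 12) / (t ^ 2 + 3))) by ring.
    apply Rmult_le_pos; [lra|apply sqrt_pos]. }
  assert (E : u - v = curve_gap t).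
  { assert (Hz : (u - v - curve_gap t) * (u - v + curve_gap t) = 0) by nra.
    apply Rmult_integral in Hz; destruct Hz as [Hz|Hz]; [lra|exfalso].
    replace (curve_gap t) with (- (u - v)) in Hgp by lra. lra. }
  unfold curve_point; rewrite <- E, Ht; unfold x; f_equal; field.
Qed.

Definition lam_term : term :=
  let v := TMul TVar TVar in
  TMul (TAdd (TMul v (TMul v v)) (TAdd (TMul (TCst 6) (TMul v v)) (TMul (TCst 12) v)))
       (TInv (TAdd v (TCst 3))).

Definition gap_term : term :=
  let v := TMul TVar TVar in
  TMul TVar (TSqrt (TMul (TAdd (TMul v v) (TAdd (TMul (TCst 3) v) (TCst 12)))
                         (TInv (TAdd v (TCst 3))))).

Lemma lam_termE (t : R) : curve_lam t = teval lam_term t.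
Proof. unfold curve_lam; simpl; unfold Rdiv; f_equal; [ring|f_equal; ring]. Qed.

Lemma gap_termE (t : R) : curve_gap t = teval gap_term t.
Proof.
  unfold curve_gap; simpl; f_equal; f_equal; unfold Rdiv; f_equal; [ring|].
  f_equal; ring.
Qed.

Lemma lam_term_def (t : R) : tdef lam_term t.
Proof. simpl; repeat split; nra. Qed.

Lemma gap_term_def (t : R) : tdef gap_term t.
Proof.
  simpl; repeat split; try nra.
  assert (H := curve_radicand_pos t).
  replace ((t * t * (t * t) + (3 * (t * t) + 12)) * / (t * t + 3))
    with ((t ^ 4 + 3 * t ^ 2 + 12) / (t ^ 2 + 3)); [exact H|].
  unfold Rdiv; f_equal; [ring|f_equal; ring].
Qed.

Lemma curve_lam_0 : curve_lam 0 = 0.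
Proof. unfold curve_lam; field; lra. Qed.

Lemma curve_point_0 : curve_point 0 = (0, 0).
Proof. unfold curve_point, curve_gap, state; f_equal; simpl; field. Qed.

Lemma curve_lam_jet :
  Derive curve_lam 0 = 0 /\ Derive_n curve_lam 2 0 = 8.
Proof.
  split.
  - change (Derive curve_lam 0) with (Derive_n curve_lam 1 0).
    rewrite (Derive_n_ext _ _ 1 0 lam_termE).
    destruct (Derive_n_teval (- 1) 1 1 lam_term (fun t _ => lam_term_def t) 0
              ltac:(lra)) as (_ & _ & ->); simpl; field; lra.
  - rewrite (Derive_n_ext _ _ 2 0 lam_termE).
    destruct (Derive_n_teval (- 1) 1 2 lam_term (fun t _ => lam_term_def t) 0
              ltac:(lra)) as (_ & _ & ->); simpl; field; lra.
Qed.

Lemma curve_point_smooth (a b : R) : smooth_curve a b curve_point.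
Proof.
  split.
  - apply smooth_term with (TMul (TCst (1 / 2))
      (TAdd (TMul (TCst 3) (TMul TVar TVar)) gap_term)).
    + intros t; unfold curve_point, state; rewrite gap_termE.
      simpl fst; set (g := gap_term); simpl; unfold g; field.
    + intros t _; assert (H := gap_term_def t); set (g := gap_term) in *; simpl; tauto.
  - apply smooth_term with (TMul (TCst (- 2)) (TMul TVar TVar)).
    + intros t; unfold curve_point, state; simpl; field.
    + intros t _; simpl; tauto.
Qed.

Lemma continuous_curve_point (t : R) : continuous curve_point t.
Proof.
  destruct (curve_point_smooth (t - 1) (t + 1)) as [H1 H2].
  assert (C1 : continuous (fun u => fst (curve_point u)) t).
  { apply (ex_derive_continuous (fun u => fst (curve_point u))).
    apply (H1 1%nat t); lra. }
  assert (C2 : continuous (fun u => snd (curve_point u)) t).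
  { apply (ex_derive_continuous (fun u => snd (curve_point u))).
    apply (H2 1%nat t); lra. }
  apply filterlim_locally; intros eps.
  assert (B1 := proj1 (filterlim_locally _ _) C1 eps).
  assert (B2 := proj1 (filterlim_locally _ _) C2 eps).
  generalize (filter_and _ _ B1 B2); apply filter_imp.
  intros u [U1 U2]; split; assumption.
Qed.

Lemma curve_velocity : velocity curve_point 0 <> (0, 0).
Proof.
  unfold velocity; intros E; injection E as E _.
  rewrite (Derive_ext _ (teval (TMul (TCst (1 / 2))
      (TAdd (TMul (TCst 3) (TMul TVar TVar)) gap_term)))) in E.
  - assert (Hd := gap_term_def 0).
    destruct (tderive_correct (TMul (TCst (1 / 2))
      (TAdd (TMul (TCst 3) (TMul TVar TVar)) gap_term)) 0) as [_ H];
      [set (g := gap_term) in *; simpl; tauto|].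
    apply is_derive_unique in H; rewrite H in E; revert E.
    simpl.
    replace ((0 * 0 * (0 * 0) + (3 * (0 * 0) + 12)) * / (0 * 0 + 3)) with (2 ^ 2)
      by (simpl; field).
    rewrite sqrt_pow2 by lra; intros E.
    ring_simplify in E; lra.
  - intros t; unfold curve_point, state; rewrite gap_termE.
    simpl fst; set (g := gap_term); simpl; unfold g; field.
Qed.

(** * Linearization and multipliers *)

(** The derivative of [F lam] at a point where [slope] takes the value [c]. *)
Definition tangent_map (c : R) (h : R * R) : R * R :=
  (- fst h - c * (fst h + snd h), - 2 * snd h + 2 * c * (fst h + snd h)).

(** The derivative of [cubic lam]. *)
Definition slope (lam s : R) : R := 3 * s ^ 2 - 6 * s - lam.

Lemma filterdiff_coord (f : R -> R -> R) (dx : R -> R -> R) (dy : R) (z : R * R) :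
  (forall x y, is_derive (fun u => f u y) x (dx x y)) ->
  is_derive (f (fst z)) (snd z) dy ->
  continuous (fun u : R * R => dx (fst u) (snd u)) z ->
  filterdiff (fun u : R * R => f (fst u) (snd u)) (locally z)
    (fun h : R * R => fst h * dx (fst z) (snd z) + snd h * dy).
Proof.
  destruct z as [x y]; simpl; intros H1 H2 H3.
  apply (is_derive_filterdiff f x y dx dy); [|exact H2|exact H3].
  apply filter_forall; intros u; apply H1.
Qed.

Lemma continuous_poly2 (c2 c1 c0 : R) (z : R * R) :
  continuous (fun u : R * R =>
    c2 * (fst u + snd u) ^ 2 + c1 * (fst u + snd u) + c0) z.
Proof.
  apply (continuous_comp (fun u : R * R => fst u + snd u)
           (fun s => c2 * s ^ 2 + c1 * s + c0)).
  - apply (continuous_plus (fun u : R * R => fst u) (fun u : R * R => snd u));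
      [apply continuous_fst | apply continuous_snd].
  - apply (ex_derive_continuous (fun s => c2 * s ^ 2 + c1 * s + c0)).
    auto_derive; trivial.
Qed.

Lemma derivative_F (lam : R) (z : R * R) :
  derivative_at (F lam) z (tangent_map (slope lam (fst z + snd z))).
Proof.
  unfold derivative_at.
  set (c := slope lam (fst z + snd z)).
  assert (H1 : filterdiff
     (fun u : R * R => - 1 * fst u + 0 * snd u + g_c lam (fst u) (snd u))
     (locally z) (fun h : R * R => fst h * (- 1 - c) + snd h * (- c))).
  { unfold c, slope.
    apply (filterdiff_coord (fun x y => - 1 * x + 0 * y + g_c lam x y)
            (fun x y => - 1 - (3 * (x + y) ^ 2 - 6 * (x + y) - lam))).
    - intros x y; unfold g_c; auto_derive; trivial; ring.
    - unfold g_c; auto_derive; trivial; ring.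
    - apply continuous_ext with (fun u : R * R =>
        - 3 * (fst u + snd u) ^ 2 + 6 * (fst u + snd u) + (lam - 1));
        [intros u; match goal with |- ?l = ?r => change (@eq R l r) end; ring
        | apply continuous_poly2]. }
  assert (H2 : filterdiff
     (fun u : R * R => 0 * fst u + - 2 * snd u + g_u lam (fst u) (snd u))
     (locally z) (fun h : R * R => fst h * (2 * c) + snd h * (- 2 + 2 * c))).
  { unfold c, slope.
    apply (filterdiff_coord (fun x y => 0 * x + - 2 * y + g_u lam x y)
            (fun x y => 2 * (3 * (x + y) ^ 2 - 6 * (x + y) - lam))).
    - intros x y; unfold g_u; auto_derive; trivial; ring.
    - unfold g_u; auto_derive; trivial; ring.
    - apply continuous_ext with (fun u : R * R =>
        6 * (fst u + snd u) ^ 2 + - 12 * (fst u + snd u) + (- 2 * lam));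
        [intros u; match goal with |- ?l = ?r => change (@eq R l r) end; ring
        | apply continuous_poly2]. }
  assert (Hp : forall G, Filter G -> filterdiff
     (fun t : R * R => (fst t, snd t)) G (fun t : R * R => (fst t, snd t))).
  { intros G FG.
    apply (filterdiff_ext (fun t : R * R => t)); [intros []; reflexivity|].
    apply (filterdiff_ext_lin _ (fun t : R * R => t)); [apply filterdiff_id|].
    intros []; reflexivity. }
  assert (H := filterdiff_comp'_2 _ _ (fun a b : R => (a, b)) z _ _ _ H1 H2
                 (Hp _ _)).
  apply (filterdiff_ext_lin _ _ _ H).
  intros [h1 h2]; unfold tangent_map; simpl; f_equal; ring.
Qed.

Lemma derivative_F_origin (lam : R) : derivative_at (F lam) (0, 0) (tangent_map (- lam)).
Proof.
  assert (H := derivative_F lam (0, 0)).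
  replace (slope lam (fst (0, 0) + snd (0, 0))) with (- lam) in H
    by (unfold slope; simpl; ring).
  exact H.
Qed.

Lemma derivative_F2 (lam : R) (z : R * R) :
  derivative_at (fun u => F lam (F lam u)) z
    (fun h => tangent_map (slope lam (fst (F lam z) + snd (F lam z)))
                 (tangent_map (slope lam (fst z + snd z)) h)).
Proof.
  apply (filterdiff_comp' (F lam) (F lam) z); apply derivative_F.
Qed.

(** By the Cayley-Hamilton theorem the characteristic polynomial of [A] at
    [mu], acting on a complex eigenvector, gives zero. Written out in real and
    imaginary parts [P] and [Q], this is a linear system of determinant
    [P ^ 2 + Q ^ 2] for the components of the eigenvector. *)
Lemma eigenvalue_char (m11 m12 m21 m22 : R) (A : R * R -> R * R) (mu : C) :
  (forall h, A h = (m11 * fst h + m12 * snd h, m21 * fst h + m22 * snd h)) ->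
  eigenvalue A mu ->
  let T := m11 + m22 in
  let D := m11 * m22 - m12 * m21 in
  Re mu ^ 2 - Im mu ^ 2 - T * Re mu + D = 0 /\ Im mu * (2 * Re mu - T) = 0.
Proof.
  intros HA ([v1 v2] & [w1 w2] & Hn & Ev & Ew) T D.
  rewrite HA in Ev, Ew; simpl in Ev, Ew.
  set (x := Re mu) in *; set (y := Im mu) in *.
  injection Ev as E1 E2; injection Ew as E3 E4.
  unfold minus, plus, opp, scal in *; simpl in *; unfold mult in *; simpl in *.
  set (P := x ^ 2 - y ^ 2 - T * x + D); set (Q := y * (2 * x - T)).
  assert (L1 : m11 * v1 + m12 * v2 - x * v1 + y * w1 = 0) by lra.
  assert (L2 : m21 * v1 + m22 * v2 - x * v2 + y * w2 = 0) by lra.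
  assert (L3 : m11 * w1 + m12 * w2 - x * w1 - y * v1 = 0) by lra.
  assert (L4 : m21 * w1 + m22 * w2 - x * w2 - y * v2 = 0) by lra.
  assert (F1 : P * v1 - Q * w1 = 0).
  { generalize (f_equal (Rmult (m22 - x)) L1) (f_equal (Rmult y) L3)
      (f_equal (Rmult m12) L2); unfold P, Q, T, D; lra. }
  assert (F2 : P * w1 + Q * v1 = 0).
  { generalize (f_equal (Rmult (m22 - x)) L3) (f_equal (Rmult y) L1)
      (f_equal (Rmult m12) L4); unfold P, Q, T, D; lra. }
  assert (F3 : P * v2 - Q * w2 = 0).
  { generalize (f_equal (Rmult (m11 - x)) L2) (f_equal (Rmult y) L4)
      (f_equal (Rmult m21) L1); unfold P, Q, T, D; lra. }
  assert (F4 : P * w2 + Q * v2 = 0).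
  { generalize (f_equal (Rmult (m11 - x)) L4) (f_equal (Rmult y) L2)
      (f_equal (Rmult m21) L3); unfold P, Q, T, D; lra. }
  destruct (Req_dec (P ^ 2 + Q ^ 2) 0) as [Z|Z].
  - assert (0 <= P ^ 2) by apply pow2_ge_0; assert (0 <= Q ^ 2) by apply pow2_ge_0.
    change (P = 0 /\ Q = 0); clearbody P Q.
    split; apply Rsqr_0_uniq; unfold Rsqr; lra.
  - exfalso; apply Hn.
    assert (K : forall v w, P * v - Q * w = 0 -> P * w + Q * v = 0 ->
                v = 0 /\ w = 0).
    { intros v w G1 G2; split; apply Rmult_eq_reg_l with (P ^ 2 + Q ^ 2); auto.
      - replace ((P ^ 2 + Q ^ 2) * v)
          with (P * (P * v - Q * w) + Q * (P * w + Q * v)) by ring.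
        rewrite G1, G2; ring.
      - replace ((P ^ 2 + Q ^ 2) * w)
          with (P * (P * w + Q * v) - Q * (P * v - Q * w)) by ring.
        rewrite G1, G2; ring. }
    destruct (K v1 w1 F1 F2) as [-> ->], (K v2 w2 F3 F4) as [-> ->]; auto.
Qed.

Lemma eigenvalue_real (A : R * R -> R * R) (mu : R) (v : R * R) :
  A (0, 0) = (0, 0) -> v <> (0, 0) -> A v = (mu * fst v, mu * snd v) ->
  eigenvalue A (RtoC mu).
Proof.
  intros H0 Hv HA; exists v, (0, 0).
  split; [intros [H _]; exact (Hv H)|].
  rewrite H0, HA; destruct v as [v1 v2].
  split; apply injective_projections; simpl;
    unfold plus, opp, scal; simpl; unfold mult; simpl; ring.
Qed.

(** The second iterate has determinant 4 and trace
    [T = (slope a - 3) (slope b - 3) - 4]. A multiplier on the unit circle is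
    then [1] or [-1] (a nonreal pair has modulus 2), so it suffices that
    [- 5 < T < 5]. The slopes add up to [(a - b) ^ 2], and their difference is
    [(a - b) (3 (a + b) - 6)]; hence [T] lies below 5 by about
    [12 (a - b) ^ 2]. *)
Lemma hyperbolic_two_cycle (lam a b : R) :
  two_cycle lam a b -> - 1 / 50 <= a + b < 0 ->
  hyperbolic_fixed_point (fun z => F lam (F lam z)) (state a b).
Proof.
  intros H Hs.
  assert (HP := proj2 (period_two_state lam a b) H).
  split; [exact (proj1 HP)|].
  exists (fun h => tangent_map (slope lam b) (tangent_map (slope lam a) h)).
  split.
  - assert (Hd := derivative_F2 lam (state a b)).
    replace (fst (state a b) + snd (state a b)) with a in Hd by (simpl; ring).
    replace (fst (F lam (state a b)) + snd (F lam (state a b))) with b in Hd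
      by (rewrite F_state, (proj1 (proj2 H)); simpl; ring).
    exact Hd.
  - intros mu Hmu Hc.
    set (c1 := slope lam a) in *; set (c2 := slope lam b) in *.
    apply (eigenvalue_char ((1 + c2) * (1 + c1) - 2 * c1 * c2)
             ((1 + c2) * c1 - c2 * (2 * c1 - 2))
             (- 2 * c2 * (1 + c1) + 2 * c1 * (2 * c2 - 2))
             (- 2 * c1 * c2 + (2 * c2 - 2) * (2 * c1 - 2))) in Hmu.
    2:{ intros [h1 h2]; unfold tangent_map; simpl; f_equal; ring. }
    destruct Hmu as [E1 E2].
    apply two_cycle_sum in H; destruct H as [Hl Hg].
    set (g := (a - b) ^ 2) in *; set (sg := a + b) in *.
    (* Sum and difference of the slopes determine their product. *)
    assert (Hsum : c1 + c2 = g).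
    { unfold c1, c2, slope, g, sg in *. nra. }
    assert (Hdiff : (c1 - c2) ^ 2 = g * (3 * sg - 6) ^ 2)
      by (unfold c1, c2, slope, g, sg; ring).
    assert (Hgp : 0 < g <= 1 / 10).
    { assert (Hq : g * (3 - sg) = - sg * (sg ^ 2 - 3 * sg + 12)) by nra.
      split.
      - apply Rmult_lt_reg_r with (3 - sg); [lra|].
        rewrite Rmult_0_l, Hq; apply Rmult_lt_0_compat; nra.
      - assert (sg ^ 2 - 3 * sg + 12 <= 13) by nra.
        apply Rmult_le_reg_r with (3 - sg); [lra|]; rewrite Hq; nra. }
    set (T := 5 - 3 * g + c1 * c2).
    assert (HT : - 5 < T < 5).
    { assert (Hpr : 4 * (c1 * c2) = g * (g - (3 * sg - 6) ^ 2)).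
      { replace (4 * (c1 * c2)) with ((c1 + c2) ^ 2 - (c1 - c2) ^ 2) by ring.
        rewrite Hsum, Hdiff; ring. }
      assert (36 <= (3 * sg - 6) ^ 2 <= 37) by nra.
      assert (g * (g - (3 * sg - 6) ^ 2) < 0)
        by (rewrite <- (Rmult_0_r g); apply Rmult_lt_compat_l; lra).
      assert (g * - 37 <= g * (g - (3 * sg - 6) ^ 2))
        by (apply Rmult_le_compat_l; lra).
      unfold T; lra. }
    assert (Hx : Re mu ^ 2 + Im mu ^ 2 = 1).
    { unfold Cmod, Re, Im in *.
      rewrite <- (pow2_sqrt (fst mu ^ 2 + snd mu ^ 2)), Hc by nra; ring. }
    set (x := Re mu) in *; set (y := Im mu) in *.
    assert (E1' : x ^ 2 - y ^ 2 - T * x + 4 = 0).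
    { rewrite <- E1; unfold T; rewrite <- Hsum; ring. }
    assert (E2' : y * (2 * x - T) = 0).
    { rewrite <- E2; unfold T; rewrite <- Hsum; ring. }
    apply Rmult_integral in E2'; destruct E2' as [Y|X].
    + rewrite Y in *; assert (Hx1 : (x - 1) * (x + 1) = 0) by nra.
      apply Rmult_integral in Hx1; destruct Hx1 as [Z|Z].
      * replace x with 1 in E1' by lra; lra.
      * replace x with (- 1) in E1' by lra; lra.
    + nra.
Qed.

(** * The period doubling bifurcation *)

(** The multiplier at the origin is the root of [m ^ 2 + (3 + l) m + 2] near
    [-1]; its derivative at [l = 0] is [1]. *)
Lemma period_doubling_F : period_doubling F 0 (0, 0).
Proof.
  assert (tangent_map_0 : forall c, tangent_map c (0, 0) = (0, 0))
    by (intros c; unfold tangent_map; simpl; f_equal; ring).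
  split; [|split].
  - exists (tangent_map (- 0)), (- 2).
    split; [|split; [|split]].
    + apply derivative_F_origin.
    + apply eigenvalue_real with (1, 0); [apply tangent_map_0| |].
      * intros E; injection E; lra.
      * unfold tangent_map; simpl; f_equal; ring.
    + apply eigenvalue_real with (0, 1); [apply tangent_map_0| |].
      * intros E; injection E; lra.
      * unfold tangent_map; simpl; f_equal; ring.
    + rewrite Rabs_left; lra.
  - exists (1 / 10), (fun _ => (0, 0)), (fun l => tangent_map (- l)),
      (fun l => (- (3 + l) + sqrt ((3 + l) ^ 2 - 8)) / 2), 1.
    assert (Hs1 : sqrt ((3 + 0) ^ 2 - 8) = 1)
      by (replace ((3 + 0) ^ 2 - 8) with 1 by ring; apply sqrt_1).
    split; [lra|split; [|split; [reflexivity|split; [|split; [|split]]]]].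
    + split; intros n t _; apply ex_derive_n_const.
    + intros l Hl; split; [|split].
      * unfold F, g_c, g_u; simpl; f_equal; ring.
      * apply derivative_F_origin.
      * set (rt := sqrt ((3 + l) ^ 2 - 8)).
        assert (Hrt : 0 <= rt) by apply sqrt_pos.
        assert (Hrt2 : rt ^ 2 = (3 + l) ^ 2 - 8) by (apply pow2_sqrt; nra).
        assert (Hrt3 : 1 / 2 < rt) by nra.
        set (m := (- (3 + l) + rt) / 2).
        (* The kernel of the second row; that of the first one degenerates at
           [l = 0]. *)
        apply eigenvalue_real with (2 + 2 * l + m, - 2 * l); [apply tangent_map_0| |].
        -- intros E; injection E as E1 E2; unfold m in E1; lra.
        -- assert (Hm : m ^ 2 + (3 + l) * m + 2 = 0) by (unfold m; nra).
           unfold tangent_map; simpl; f_equal; nra.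
    + rewrite Hs1; field.
    + auto_derive; [simpl; lra|].
      replace ((3 + 0) * ((3 + 0) * 1) + - (8)) with ((3 + 0) ^ 2 - 8) by ring.
      rewrite Hs1; field.
    + lra.
  - exists (1 / 10), curve_lam, curve_point.
    split; [lra|]; split.
    { apply smooth_term with lam_term; [apply lam_termE|intros; apply lam_term_def]. }
    split; [apply curve_point_smooth|].
    split; [apply curve_lam_0|]; split; [apply curve_point_0|].
    split; [apply curve_velocity|].
    destruct curve_lam_jet as [J1 J2].
    split; [exact J1|]; split; [rewrite J2; lra|]; split.
    + intros t Ht Ht0.
      assert (H := curve_two_cycle t Ht0).
      split; [apply period_two_state, H|].
      apply hyperbolic_two_cycle; [exact H|].
      assert (0 < t ^ 2) by (apply pow2_gt_0, Ht0).
      nra.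
    + exists (1 / 50); split; [lra|].
      intros l z _ Hz HP.
      rewrite (state_surj z) in HP |- *.
      set (u := fst z + snd z) in *; set (v := - fst z - snd z / 2) in *.
      assert (Hy : Rabs (2 * (u + v)) < 1 / 50).
      { destruct Hz as [_ Hz]; change (Rabs (snd z - 0) < 1 / 50) in Hz.
        replace (2 * (u + v)) with (snd z - 0) by (unfold u, v; field); exact Hz. }
      apply Rabs_def2 in Hy.
      apply period_two_state in HP.
      destruct (two_cycle_on_curve l u v ltac:(lra) HP) as (t & Ht & El & Ez).
      exists t; split; [nra|split; assumption].
Qed.

(** The root [v] of the cubic equation is a Lipschitz function of the
    parameter because [l = v ^ 2 + 3 v + 3 - 9 / (v + 3)], and the point of the
    curve with [t = sqrt v] depends continuously on it. *)
Lemma bifurcating_orbit_exists (l1 : R) :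
  exists q, bifurcating_orbit F 0 (0, 0) l1 q.
Proof.
  set (v := fun l => proj1_sig (ex_sum_root (Rmax 0 l) (Rmax_l 0 l))).
  assert (Hv : forall l, 0 <= l ->
            0 <= v l /\ l * (v l + 3) = v l ^ 3 + 6 * v l ^ 2 + 12 * v l).
  { intros l Hl; unfold v.
    destruct (ex_sum_root (Rmax 0 l) (Rmax_l 0 l)) as (x & Hx & E); simpl.
    rewrite Rmax_right in E by exact Hl; split; assumption. }
  clearbody v.
  assert (Hlip : forall l l', 0 <= l -> 0 <= l' -> Rabs (v l' - v l) <= Rabs (l' - l)).
  { intros l l' Hl Hl'.
    destruct (Hv l Hl) as [P E], (Hv l' Hl') as [P' E'].
    set (x := v l) in *; set (x' := v l') in *.
    set (k := x + x' + 3 + 9 / ((x + 3) * (x' + 3))).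
    assert (Hk : 1 <= k).
    { unfold k.
      assert (0 <= 9 / ((x + 3) * (x' + 3))); [|lra].
      apply Rlt_le, Rdiv_lt_0_compat; [lra|apply Rmult_lt_0_compat; lra]. }
    assert (Ed : l' - l = (x' - x) * k).
    { replace l' with ((x' ^ 3 + 6 * x' ^ 2 + 12 * x') / (x' + 3))
        by (rewrite <- E'; field; lra).
      replace l with ((x ^ 3 + 6 * x ^ 2 + 12 * x) / (x + 3))
        by (rewrite <- E; field; lra).
      unfold k; field; lra. }
    rewrite Ed, Rabs_mult, (Rabs_pos_eq k) by lra.
    assert (H := Rabs_pos (x' - x)); nra. }
  exists (fun l => curve_point (sqrt (v l))).
  split; [|split].
  - destruct (Hv 0 (Rle_refl 0)) as [P E].
    assert (0 <= v 0 ^ 3) by (apply pow_le; lra).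
    replace (v 0) with 0 by nra.
    rewrite sqrt_0; apply curve_point_0.
  - intros l Hl.
    apply filterlim_comp with (locally (sqrt (v l))); [|apply continuous_curve_point].
    apply filterlim_comp with (locally (v l)); [|apply continuous_sqrt].
    apply filterlim_locally; intros eps.
    exists eps; intros l' Hb Hl'.
    change (Rabs (l' - l) < eps) in Hb; change (Rabs (v l' - v l) < eps).
    apply Rle_lt_trans with (2 := Hb); apply Hlip; lra.
  - intros l Hl.
    destruct (Hv l ltac:(lra)) as [P E].
    assert (Hvp : v l <> 0) by (intros Z; rewrite Z in E; lra).
    assert (Hs2 : sqrt (v l) ^ 2 = v l) by (apply pow2_sqrt, P).
    assert (Hs : sqrt (v l) <> 0) by (intros Z; rewrite Z in Hs2; lra).
    assert (H := curve_two_cycle _ Hs).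
    replace (curve_lam (sqrt (v l))) with l in H.
    + apply period_two_state, H.
    + apply Rmult_eq_reg_r with (v l + 3); [|lra].
      assert (E' := curve_lam_eq (sqrt (v l))); rewrite Hs2 in E'; lra.
Qed.

(** * Power series linearizing the recurrence on the stable manifold *)

(** Recursive definition of a sequence whose term [n] is computed from the
    earlier ones: iterating [G] from any sequence stabilizes one term at each
    step. *)
Lemma causal_fixpoint (G : (nat -> R) -> nat -> R) :
  (forall a b n, (forall j, (j < n)%nat -> a j = b j) -> G a n = G b n) ->
  exists a : nat -> R, forall n, a n = G a n.
Proof.
  intros HG.
  set (it := fix it n := match n with O => fun _ => 0 | S m => G (it m) end).
  assert (Hst : forall k n m, (k < n)%nat -> (k < m)%nat -> it n k = it m k).
  { intros k; induction k as [k IH] using lt_wf_ind; intros n m Hn Hm.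
    destruct n as [|n]; [lia|]; destruct m as [|m]; [lia|]; simpl.
    apply HG; intros j Hj; apply IH; lia. }
  exists (fun n => it (S n) n); intros n; simpl.
  apply HG; intros j Hj; exact (Hst j n (S j) Hj (le_n _)).
Qed.

Lemma PS_mult_ext_le (a a' b b' : nat -> R) (n : nat) :
  (forall j, (j <= n)%nat -> a j = a' j) ->
  (forall j, (j <= n)%nat -> b j = b' j) ->
  PS_mult a b n = PS_mult a' b' n.
Proof.
  intros Ha Hb; unfold PS_mult; apply sum_eq; intros i Hi.
  rewrite Ha, Hb by lia; reflexivity.
Qed.

Lemma PS_mult_bound (a b : nat -> R) (A B q : R) (n : nat) :
  (forall j, (j <= n)%nat -> Rabs (a j) <= A * q ^ j) ->
  (forall j, (j <= n)%nat -> Rabs (b j) <= B * q ^ j) ->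
  Rabs (PS_mult a b n) <= (INR n + 1) * (A * B * q ^ n).
Proof.
  intros Ha Hb; unfold PS_mult.
  eapply Rle_trans; [apply Rsum_abs|].
  rewrite <- S_INR, Rmult_comm, <- sum_cte.
  apply sum_Rle; intros i Hi.
  rewrite Rabs_mult.
  replace (A * B * q ^ n) with ((A * q ^ i) * (B * q ^ (n - i))).
  - apply Rmult_le_compat; try apply Rabs_pos; [apply Ha | apply Hb]; lia.
  - replace (q ^ n) with (q ^ i * q ^ (n - i)); [ring|].
    rewrite <- pow_add; f_equal; lia.
Qed.

(** The operator
    [s |-> s (- t / r) + (2 r + 1 / r) s t + 2 s (- r t)] multiplies [t ^ k] by
    [weight r k]. *)
Definition weight (r : R) (k : nat) : R :=
  (- / r) ^ k + (2 * r + / r) + 2 * (- r) ^ k.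

(** The number [- / r] is a multiplier of the linearized recurrence, so the
    coefficient of [t] in the series remains free. *)
Lemma weight_1 (r : R) : weight r 1 = 0.
Proof. unfold weight; ring. Qed.

Lemma pow_neg_double (x : R) (m : nat) : (- x) ^ (2 * m) = x ^ (2 * m).
Proof. rewrite !pow_mult; f_equal; ring. Qed.

(** There is no resonance. For even [k] all terms are positive; for odd [k],
    with [z = r ^ (k - 1)], the weight is
    [- (z r - r) (2 - 1 / (r ^ 2 z))]. *)
Lemma weight_bound (r : R) (k : nat) :
  1 < r -> (2 <= k)%nat -> (1 - / r ^ 2) * r ^ k <= Rabs (weight r k).
Proof.
  intros Hr Hk.
  assert (Hi : 0 < / r) by (apply Rinv_0_lt_compat; lra).
  assert (Hi2 : 0 < / r ^ 2) by (apply Rinv_0_lt_compat, pow_lt; lra).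
  assert (Hp : 0 < r ^ k) by (apply pow_lt; lra).
  destruct (Nat.Even_or_Odd k) as [[m ->]|[m ->]].
  - unfold weight; rewrite !pow_neg_double.
    assert (0 < (/ r) ^ (2 * m)) by (apply pow_lt; lra).
    rewrite Rabs_pos_eq; nra.
  - unfold weight; rewrite !pow_add, !pow_neg_double, !pow_1 in *.
    set (z := r ^ (2 * m)) in *.
    assert (Hz : r ^ 2 <= z) by (apply Rle_pow; [lra | lia]).
    rewrite pow_inv; fold z.
    assert (Hr2 : 1 < r ^ 2) by nra.
    assert (E : / z * - / r + (2 * r + / r) + 2 * (z * - r)
            = - ((z * r - r) * (2 - / (r ^ 2 * z)))) by (field; split; nra).
    rewrite E, Rabs_Ropp.
    assert (H1 : / (r ^ 2 * z) <= 1).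
    { rewrite <- Rinv_1; apply Rinv_le_contravar; nra. }
    assert (H2 : r <= / r ^ 2 * (z * r)).
    { replace r with (/ r ^ 2 * (r ^ 2 * r)) at 1 by (field; lra).
      apply Rmult_le_compat_l; nra. }
    assert (H3 : 0 <= z * r - r) by nra.
    rewrite Rabs_pos_eq; nra.
Qed.

(** Bernoulli's inequality, squared. It lets a geometric factor absorb the
    number of terms of a Cauchy product. *)
Lemma pow_ge_square (q : R) (n : nat) :
  1 < q <= 2 -> (q - 1) ^ 2 * (INR n + 1) ^ 2 <= (q ^ 2) ^ n.
Proof.
  intros Hq.
  assert (H := poly n (q - 1) ltac:(lra)).
  replace (1 + (q - 1)) with q in H by ring.
  assert (Hn := pos_INR n).
  rewrite <- Rpow_mult_distr, <- pow_mult, Nat.mul_comm, pow_mult.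
  apply pow_incr; nra.
Qed.

(** Coefficients of [t S ^ 3 - 3 S ^ 2] for the series [S] with coefficients [a],
    that is, of [(s ^ 3 - 3 s ^ 2) / t ^ 2] for [s = t S]. *)
Definition forcing (a : nat -> R) (n : nat) : R :=
  match n with O => 0 | S i => PS_mult a (PS_mult a a) i end
  - 3 * PS_mult a a n.

Lemma forcing_ext (a b : nat -> R) (n : nat) :
  (forall j, (j <= n)%nat -> a j = b j) -> forcing a n = forcing b n.
Proof.
  intros H; unfold forcing.
  rewrite (PS_mult_ext_le a b a b n H H).
  destruct n as [|n]; [reflexivity|].
  rewrite (PS_mult_ext_le a b (PS_mult a a) (PS_mult b b) n); [reflexivity| |].
  - intros j Hj; apply H; lia.
  - intros j Hj; apply PS_mult_ext_le; intros i Hi; apply H; lia.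
Qed.

Lemma forcing_bound (a : nat -> R) (A q : R) (n : nat) :
  0 < q <= 1 ->
  (forall j, (j <= n)%nat -> Rabs (a j) <= A * q ^ j) ->
  Rabs (forcing a n) <= (INR n + 1) ^ 2 * ((A ^ 3 / q + 3 * A ^ 2) * q ^ n).
Proof.
  intros Hq Ha.
  assert (HA : 0 <= A).
  { specialize (Ha 0%nat ltac:(lia)); simpl in Ha.
    assert (H := Rabs_pos (a 0%nat)); lra. }
  assert (Hqn : 0 < q ^ n) by (apply pow_lt; lra).
  assert (Hn := pos_INR n).
  assert (H2 : Rabs (PS_mult a a n) <= (INR n + 1) * (A * A * q ^ n))
    by (apply PS_mult_bound; assumption).
  assert (H3 : Rabs (match n with
                     | O => 0 | S i => PS_mult a (PS_mult a a) i end)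
               <= (INR n + 1) ^ 2 * (A ^ 3 / q * q ^ n)).
  { destruct n as [|i].
    - rewrite Rabs_R0; simpl.
      assert (0 <= A ^ 3 / q); [|simpl in *; nra].
      apply Rdiv_le_0_compat; [apply pow_le; lra | lra].
    - eapply Rle_trans.
      + apply (PS_mult_bound a (PS_mult a a) A ((INR i + 1) * (A * A)) q i).
        * intros j Hj; apply Ha; lia.
        * intros j Hj.
          eapply Rle_trans; [apply (PS_mult_bound a a A A q)|].
          -- intros l Hl; apply Ha; lia.
          -- intros l Hl; apply Ha; lia.
          -- assert (0 <= q ^ j) by (apply pow_le; lra).
             assert (INR j <= INR i) by (apply le_INR; lia).
             assert (0 <= A * A * q ^ j) by (apply Rmult_le_pos; nra).
             nra.
      + rewrite S_INR.
        assert (Hi := pos_INR i).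
        assert (Hqi : 0 < q ^ i) by (apply pow_lt; lra).
        replace (A ^ 3 / q * q ^ S i) with (A ^ 3 * q ^ i) by (simpl; field; lra).
        assert (0 <= A ^ 3 * q ^ i)
          by (apply Rmult_le_pos; [apply pow_le; lra | lra]).
        replace ((INR i + 1) * (A * ((INR i + 1) * (A * A)) * q ^ i))
          with ((INR i + 1) ^ 2 * (A ^ 3 * q ^ i)) by ring.
        apply Rmult_le_compat_r; [assumption|nra]. }
  assert (H4 : (INR n + 1) * (A * A * q ^ n)
               <= (INR n + 1) ^ 2 * (A ^ 2 * q ^ n)).
  { replace (A * A) with (A ^ 2) by ring.
    apply Rmult_le_compat_r; [apply Rmult_le_pos; [nra|lra] | nra]. }
  unfold forcing.
  eapply Rle_trans; [apply Rabs_triang|].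
  rewrite Rabs_Ropp, Rabs_mult, (Rabs_pos_eq 3) by lra.
  lra.
Qed.

(** The recursion determines the coefficients from the first one. The weights
    grow like the powers of [r = Q ^ 2], whereas the forcing loses only a factor
    [(n + 1) ^ 2], which is at most a multiple of [Q ^ n]. If the first
    coefficient [e] is small, all coefficients are bounded by [e]; and a bound by
    the powers of [p] improves to one by the powers of [p / Q], so that the
    radius of convergence is infinite. The argument [q] serves as a fourth root
    of [r]. *)
Lemma stable_series (q : R) :
  1 < q <= 2 ->
  exists a : nat -> R,
    0 < a 0%nat /\
    (forall n, weight ((q ^ 2) ^ 2) (S (S n)) * a (S n) = forcing a n) /\
    CV_radius a = p_infty.
Proof.
  intros Hq.
  set (Q := q ^ 2); set (r := Q ^ 2).
  assert (HQ : 1 < Q) by (unfold Q; nra).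
  assert (Hr : 1 < r) by (unfold r; nra).
  assert (Hr2 : 1 < r ^ 2) by nra.
  set (c := 1 - / r ^ 2).
  assert (Hc : 0 < c < 1).
  { assert (/ r ^ 2 < 1) by (rewrite <- Rinv_1; apply Rinv_lt_contravar; lra).
    assert (0 < / r ^ 2) by (apply Rinv_0_lt_compat; lra).
    unfold c; lra. }
  set (h := (q - 1) ^ 2).
  assert (Hh : 0 < h <= 1) by (unfold h; nra).
  assert (HQn : forall n, 1 <= Q ^ n) by (intros n; apply pow_R1_Rle; lra).
  assert (Hsq : forall n, h * (INR n + 1) ^ 2 <= Q ^ n)
    by (intros n; apply pow_ge_square; exact Hq).
  assert (Hw : forall n, c * (Q ^ n * Q ^ n) <= Rabs (weight r (S (S n)))).
  { intros n.
    assert (H1 := weight_bound r (S (S n)) Hr ltac:(lia)); fold c in H1.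
    eapply Rle_trans; [|exact H1]; apply Rmult_le_compat_l; [lra|].
    rewrite <- Rpow_mult_distr; replace (Q * Q) with r by (unfold r; ring).
    apply Rle_pow; [lra | lia]. }
  assert (Hw0 : forall n, 0 < Rabs (weight r (S (S n)))).
  { intros n; apply Rlt_le_trans with (2 := Hw n); specialize (HQn n).
    apply Rmult_lt_0_compat; nra. }
  set (e := c * h / 4).
  assert (He : 0 < e <= 1) by (unfold e; nra).
  destruct (causal_fixpoint (fun a n => match n with
      | O => e | S m => forcing a m / weight r (S (S m)) end)) as [a Ha].
  { intros a b [|n] H; [reflexivity|].
    rewrite (forcing_ext a b n); [reflexivity|]; intros j Hj; apply H; lia. }
  assert (Hrec : forall n, weight r (S (S n)) * a (S n) = forcing a n).
  { intros n; rewrite (Ha (S n)); field; intros E.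
    specialize (Hw0 n); rewrite E, Rabs_R0 in Hw0; lra. }
  (* Quadratic and cubic terms contribute at most [4 e ^ 2 (n + 1) ^ 2], and
     [e = c h / 4] is what the weights then reduce to [e]. *)
  assert (Hb0 : forall n, Rabs (a n) <= e).
  { intros n; induction n as [n IH] using lt_wf_ind; destruct n as [|n].
    - rewrite (Ha 0%nat), Rabs_pos_eq; lra.
    - assert (Hf : Rabs (forcing a n)
                   <= (INR n + 1) ^ 2 * ((e ^ 3 / 1 + 3 * e ^ 2) * 1 ^ n)).
      { apply forcing_bound; [lra|].
        intros j Hj; rewrite pow1, Rmult_1_r; apply IH; lia. }
      rewrite pow1, <- Hrec, Rabs_mult in Hf.
      specialize (Hw n); specialize (Hw0 n); specialize (Hsq n).
      specialize (HQn n).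
      set (W := Rabs (weight r (S (S n)))) in *.
      apply Rmult_le_reg_l with W; [exact Hw0|].
      eapply Rle_trans; [exact Hf|].
      assert (H : c * (h * (INR n + 1) ^ 2) <= W).
      { apply Rle_trans with (2 := Hw); apply Rmult_le_compat_l; [lra|].
        apply Rle_trans with (1 := Hsq); clear - HQn; nra. }
      replace (c * (h * (INR n + 1) ^ 2)) with (4 * e * (INR n + 1) ^ 2) in H
        by (unfold e; field).
      apply Rle_trans with (2 := Rmult_le_compat_r e _ _ ltac:(lra) H).
      replace (4 * e * (INR n + 1) ^ 2 * e)
        with ((INR n + 1) ^ 2 * (4 * e ^ 2)) by ring.
      apply Rmult_le_compat_l; [apply pow2_ge_0|].
      clear - He; unfold Rdiv; rewrite Rinv_1; nra. }
  assert (HiQ : 0 < / Q <= 1).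
  { split; [apply Rinv_0_lt_compat; lra|].
    rewrite <- Rinv_1; apply Rinv_le_contravar; lra. }
  (* The constants deteriorate with [m], but only finiteness matters. *)
  assert (Hb : forall m, exists A, forall n, Rabs (a n) <= A * ((/ Q) ^ m) ^ n).
  { induction m as [|m [A IH]].
    - exists e; intros n; simpl; rewrite pow1, Rmult_1_r; apply Hb0.
    - set (p := (/ Q) ^ m) in *.
      assert (Hp : 0 < p <= 1).
      { split; [apply pow_lt; lra|].
        unfold p; rewrite <- (pow1 m); apply pow_incr; lra. }
      set (B := (A ^ 3 / p + 3 * A ^ 2)).
      assert (HB : 0 <= B).
      { assert (0 <= A).
        { specialize (IH 0%nat); simpl in IH.
          assert (H := Rabs_pos (a 0%nat)); lra. }
        unfold B.
        assert (0 <= A ^ 3 / p)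
          by (apply Rdiv_le_0_compat; [apply pow_le; lra | lra]); nra. }
      set (A' := B / (c * h) * / ((/ Q) ^ S m)).
      exists (Rmax e A'); intros [|n].
      + simpl; rewrite Rmult_1_r; eapply Rle_trans; [apply Hb0|apply Rmax_l].
      + assert (Hpq : 0 < (/ Q) ^ S m) by (apply pow_lt; lra).
        apply Rle_trans with (A' * ((/ Q) ^ S m) ^ S n).
        2:{ apply Rmult_le_compat_r; [apply pow_le; lra | apply Rmax_r]. }
        assert (Hf := forcing_bound a A p n Hp (fun j _ => IH j)).
        fold B in Hf.
        rewrite <- Hrec, Rabs_mult in Hf.
        specialize (Hw n); specialize (Hw0 n); specialize (Hsq n).
        specialize (HQn n).
        set (W := Rabs (weight r (S (S n)))) in *.
        apply Rmult_le_reg_l with W; [exact Hw0|].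
        eapply Rle_trans; [exact Hf|].
        assert (Hpn : 0 < p ^ n) by (apply pow_lt; lra).
        replace (A' * ((/ Q) ^ S m) ^ S n)
          with (B * p ^ n * / (c * h * Q ^ n)).
        2:{ unfold A'; replace ((/ Q) ^ S m) with (/ Q * p) by reflexivity.
            replace ((/ Q * p) ^ S n) with (/ Q * p * (/ Q ^ n * p ^ n))
              by (rewrite <- pow_inv, <- Rpow_mult_distr; reflexivity).
            field; repeat split; lra. }
        apply Rle_trans
          with (c * (Q ^ n * Q ^ n) * (B * p ^ n * / (c * h * Q ^ n))).
        2:{ apply Rmult_le_compat_r; [|exact Hw].
            apply Rmult_le_pos; [nra|].
            apply Rlt_le, Rinv_0_lt_compat, Rmult_lt_0_compat; nra. }
        replace (c * (Q ^ n * Q ^ n) * (B * p ^ n * / (c * h * Q ^ n)))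
          with ((Q ^ n / h) * (B * p ^ n)) by (field; repeat split; lra).
        apply Rmult_le_compat_r; [nra|].
        apply Rmult_le_reg_r with h; [lra|].
        replace (Q ^ n / h * h) with (Q ^ n) by (field; lra).
        lra. }
  exists a; split; [rewrite (Ha 0%nat); lra|split; [exact Hrec|]].
  destruct (CV_radius_bounded a) as [Hub _].
  assert (Hm : forall m, Rbar_le (Q ^ m) (CV_radius a)).
  { intros m; apply Hub; destruct (Hb m) as [A HA]; exists A; intros n.
    assert (0 < Q ^ m) by (apply pow_lt; lra).
    rewrite Rabs_mult, (Rabs_pos_eq ((Q ^ m) ^ n)) by (apply pow_le; lra).
    specialize (HA n); rewrite !pow_inv in HA.
    assert (Hz : 0 < (Q ^ m) ^ n) by (apply pow_lt; lra).
    apply Rmult_le_reg_r with (/ (Q ^ m) ^ n); [apply Rinv_0_lt_compat; lra|].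
    replace (Rabs (a n) * (Q ^ m) ^ n * / (Q ^ m) ^ n) with (Rabs (a n))
      by (field; lra); exact HA. }
  destruct (CV_radius a) as [x| |] eqn:E; [|reflexivity|].
  - destruct (Pow_x_infinity Q ltac:(rewrite Rabs_pos_eq; lra) (x + 1))
      as [N HN].
    specialize (HN N (le_n _)); specialize (Hm N); simpl in Hm.
    rewrite Rabs_pos_eq in HN by (apply pow_le; lra); lra.
  - destruct (Hm 0%nat).
Qed.

Lemma entire_lt (a : nat -> R) (x : R) :
  CV_radius a = p_infty -> Rbar_lt (Rabs x) (CV_radius a).
Proof. intros ->; exact I. Qed.

Lemma entire_mult (a b : nat -> R) :
  CV_radius a = p_infty -> CV_radius b = p_infty ->
  CV_radius (PS_mult a b) = p_infty.
Proof.
  intros Ha Hb.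
  destruct (CV_radius (PS_mult a b)) as [x| |] eqn:E; [|reflexivity|].
  - exfalso.
    assert (Hx : 0 <= x) by (generalize (CV_radius_ge_0 (PS_mult a b)); rewrite E; auto).
    apply (CV_disk_outside (PS_mult a b) (x + 1)).
    + rewrite E; simpl; rewrite Rabs_pos_eq; lra.
    + assert (H := ex_pseries_mult a b (x + 1) (entire_lt _ _ Ha) (entire_lt _ _ Hb)).
      apply ex_pseries_R, ex_series_lim_0 in H; exact H.
  - generalize (CV_radius_ge_0 (PS_mult a b)); rewrite E; simpl; tauto.
Qed.

Lemma PSeries_dilate (a : nat -> R) (x t : R) :
  PSeries (fun n => x ^ n * a n) t = PSeries a (x * t).
Proof.
  apply Series_ext; intros n; rewrite Rpow_mult_distr; ring.
Qed.

Lemma ex_pseries_dilate (a : nat -> R) (x t : R) :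
  CV_radius a = p_infty -> ex_pseries (fun n => x ^ n * a n) t.
Proof.
  intros Ha.
  assert (H := CV_radius_inside a (x * t) (entire_lt _ _ Ha)).
  apply ex_pseries_R; apply ex_pseries_R in H.
  eapply ex_series_ext; [|exact H]; intros n; simpl.
  rewrite Rpow_mult_distr; ring.
Qed.

(** Comparison of coefficients: the left-hand side is [t] times the series with
    coefficients [weight r (n + 1) * a n], whose constant term vanishes. *)
Lemma weighted_series (r : R) (a : nat -> R) (t : R) :
  CV_radius a = p_infty ->
  (forall n, weight r (S (S n)) * a (S n) = forcing a n) ->
  let s := fun t => t * PSeries a t in
  s (- / r * t) + (2 * r + / r) * s t + 2 * s (- r * t)
  = s t ^ 3 - 3 * s t ^ 2.
Proof.
  intros Ha Hrec s.
  assert (Hex := fun x => CV_radius_inside a x (entire_lt _ _ Ha)).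
  set (b := fun n => weight r (S n) * a n).
  assert (Hb : forall n, b n = PS_plus (PS_scal (- / r) (fun n => (- / r) ^ n * a n))
     (PS_plus (PS_scal (2 * r + / r) a)
              (PS_scal (- 2 * r) (fun n => (- r) ^ n * a n))) n).
  { intros n; unfold b, weight, PS_plus, PS_scal, plus, scal, mult; simpl.
    unfold mult; simpl. ring. }
  assert (Hsc : forall (c : R) (u : nat -> R),
            ex_pseries u t -> ex_pseries (PS_scal c u) t).
  { intros c u H; apply ex_pseries_scal; [apply Rmult_comm | exact H]. }
  assert (X1 := Hsc (- / r) _ (ex_pseries_dilate a (- / r) t Ha)).
  assert (X2 := Hsc (2 * r + / r) _ (Hex t)).
  assert (X3 := Hsc (- 2 * r) _ (ex_pseries_dilate a (- r) t Ha)).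
  assert (X23 := ex_pseries_plus _ _ t X2 X3).
  assert (E1 : PSeries b t = - / r * PSeries a (- / r * t)
     + ((2 * r + / r) * PSeries a t + - 2 * r * PSeries a (- r * t))).
  { rewrite (PSeries_ext _ _ _ Hb).
    rewrite (PSeries_plus _ _ t X1 X23), (PSeries_plus _ _ t X2 X3).
    rewrite !PSeries_scal, !PSeries_dilate; reflexivity. }
  assert (Hexb : ex_pseries b t).
  { apply (ex_pseries_ext _ b t (fun n => eq_sym (Hb n))).
    exact (ex_pseries_plus _ _ t X1 X23). }
  assert (E2 : PSeries b t = t * PSeries (forcing a) t).
  { rewrite PSeries_decr_1 by exact Hexb.
    replace (b 0%nat) with 0 by (unfold b; rewrite weight_1; ring).
    rewrite Rplus_0_l; f_equal; apply PSeries_ext; intros n; apply Hrec. }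
  assert (H2 := entire_mult a a Ha Ha).
  assert (H3 := entire_mult a (PS_mult a a) Ha H2).
  assert (E3 : PSeries (forcing a) t
               = t * PSeries a t ^ 3 - 3 * PSeries a t ^ 2).
  { rewrite (PSeries_ext _ (PS_plus (PS_incr_1 (PS_mult a (PS_mult a a)))
                                    (PS_scal (- 3) (PS_mult a a)))).
    - rewrite PSeries_plus, PSeries_incr_1, PSeries_scal, !PSeries_mult;
        try (apply entire_lt; assumption); [ring|..].
      + apply ex_pseries_incr_1, CV_radius_inside, entire_lt, H3.
      + apply Hsc, CV_radius_inside, entire_lt, H2.
    - intros [|n]; unfold forcing, PS_plus, PS_incr_1, PS_scal, plus, scal;
        simpl; unfold mult, zero; simpl; ring. }
  unfold s; rewrite E2, E3 in E1.
  replace ((t * PSeries a t) ^ 3 - 3 * (t * PSeries a t) ^ 2)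
    with (t * (t * (t * PSeries a t ^ 3 - 3 * PSeries a t ^ 2))) by ring.
  rewrite E1; ring.
Qed.

(** The function [s] linearizes the dynamics on the stable manifold of the
    origin, a step forward being the multiplication of [t] by [- / r]; as it is
    entire, one formula covers the whole manifold. *)
Lemma stable_manifold_function (r : R) :
  1 < r <= 2 ->
  exists s S s' : R -> R,
    (forall t, s t = t * S t) /\
    (forall t, s (- / r * t) + (2 * r + / r) * s t + 2 * s (- r * t)
               = s t ^ 3 - 3 * s t ^ 2) /\
    (forall n t, ex_derive_n s n t) /\
    (forall t, is_derive s t (s' t)) /\
    continuous S 0 /\ 0 < S 0 /\ continuous s' 0 /\ 0 < s' 0.
Proof.
  intros Hr.
  assert (Hs : forall x, 1 < x <= 2 -> 1 < sqrt x <= 2).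
  { intros x Hx; split.
    - rewrite <- sqrt_1; apply sqrt_lt_1; lra.
    - apply Rle_trans with (sqrt (2 ^ 2)); [apply sqrt_le_1; lra|].
      rewrite sqrt_pow2; lra. }
  destruct (stable_series (sqrt (sqrt r)) (Hs _ (Hs _ Hr)))
    as (a & Ha0 & Hrec & Hinf).
  rewrite !pow2_sqrt in Hrec by (try apply sqrt_pos; lra).
  set (c := PS_incr_1 a).
  assert (Hc : CV_radius c = p_infty) by (unfold c; rewrite CV_radius_incr_1; exact Hinf).
  assert (Hct : forall t, PSeries c t = t * PSeries a t)
    by (intros t; apply PSeries_incr_1).
  exists (PSeries c), (PSeries a), (PSeries (PS_derive c)).
  split; [exact Hct|].
  split.
  { intros t; rewrite !Hct; exact (weighted_series r a t Hinf Hrec). }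
  split.
  { intros n t; apply ex_derive_n_PSeries, entire_lt, Hc. }
  split.
  { intros t; apply is_derive_PSeries, entire_lt, Hc. }
  repeat split.
  - apply continuity_pt_filterlim, PSeries_continuity, entire_lt, Hinf.
  - rewrite PSeries_0; exact Ha0.
  - apply continuity_pt_filterlim, PSeries_continuity, entire_lt.
    rewrite CV_radius_derive; exact Hc.
  - rewrite PSeries_0; unfold PS_derive, c, PS_incr_1; simpl; lra.
Qed.

(** The factor [S] and the derivative [s'] are recorded because both start
    from a positive value at [t = 0], from which the cone conditions near the
    origin are read off. The field [sb_trace] says that the stable multiplier is
    [- 1 + lam] up to second order. *)
Record stable_branch (lam r : R) (s S s' : R -> R) : Prop := {
  sb_rate : 1 < r <= 101 / 100;
  sb_trace : Rabs (lam - (r - 1)) <= 4 * lam ^ 2;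
  sb_factor : forall t, s t = t * S t;
  sb_rec : forall t, s (- / r * t) + 3 * s t + 2 * s (- r * t) = cubic lam (s t);
  sb_smooth : forall n t, ex_derive_n s n t;
  sb_deriv : forall t, is_derive s t (s' t);
  sb_cont : continuous S 0;
  sb_pos : 0 < S 0;
  sb_cont' : continuous s' 0;
  sb_pos' : 0 < s' 0
}.

Lemma stable_branch_exists (lam : R) :
  0 < lam <= 1 / 10000 -> exists r s S s', stable_branch lam r s S s'.
Proof.
  intros Hl.
  set (D := (1 - lam) ^ 2 + 8 * lam).
  set (k := (lam - 1 + sqrt D) / 4).
  assert (HD : sqrt D ^ 2 = D) by (apply pow2_sqrt; unfold D; nra).
  assert (Hk : k * (2 * k + 1 - lam) = lam).
  { replace (k * (2 * k + 1 - lam)) with ((sqrt D ^ 2 - (1 - lam) ^ 2) / 8)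
      by (unfold k; field).
    rewrite HD; unfold D; field. }
  assert (Hk0 : 0 < k).
  { assert (1 - lam < sqrt D); [|unfold k; lra].
    rewrite <- (sqrt_pow2 (1 - lam)) by lra.
    apply sqrt_lt_1; unfold D; nra. }
  assert (Hk1 : k <= 2 * lam) by nra.
  assert (Htr : 2 * (1 + k) + / (1 + k) = 3 + lam).
  { apply Rmult_eq_reg_r with (1 + k); [|lra].
    replace ((2 * (1 + k) + / (1 + k)) * (1 + k)) with (2 * (1 + k) ^ 2 + 1)
      by (field; lra). lra. }
  destruct (stable_manifold_function (1 + k) ltac:(lra))
    as (s & S & s' & H1 & H2 & H3 & H4 & H5 & H6 & H7 & H8).
  exists (1 + k), s, S, s'; constructor; auto.
  - lra.
  - apply Rabs_le; nra.
  - intros t; specialize (H2 t); rewrite Htr in H2; unfold cubic; lra.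
Qed.

(** * The invariant cone and the second-order approximation of the curve *)

(** Pairs of consecutive differences [d1 = s (n+1) - s' (n+1)] and
    [d0 = s n - s' n] whose ratio is close to [-1], with [d0] positive. *)
Definition cone (d1 d0 : R) : Prop :=
  d1 < 0 /\ - (19 / 20) * d1 <= d0 <= - (21 / 20) * d1.

Lemma cone_scale (c d1 d0 : R) : 0 < c -> cone d1 d0 -> cone (c * d1) (c * d0).
Proof. unfold cone; intros; nra. Qed.

(** Backward in time the ratio [d0 / d1] is mapped by
    [k |-> (m - 3 - 1 / k) / 2], which for small [m] contracts towards a fixed
    point near [-1]. The sign alternates at every step, hence the opposites. *)
Lemma cone_step (m d1 d0 dm : R) :
  Rabs m <= 1 / 25 -> d1 + 3 * d0 + 2 * dm = m * d0 ->
  cone d1 d0 -> cone (- d0) (- dm).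
Proof.
  unfold cone; intros Hm E H; apply Rabs_le_between in Hm.
  assert (Hd : 0 < d0) by lra.
  assert (m * d0 <= 1 / 25 * d0) by nra.
  assert (- (1 / 25) * d0 <= m * d0) by nra.
  lra.
Qed.

Lemma cone_neg_step (sg m d1 d0 dm : R) :
  Rabs m <= 1 / 25 -> d1 + 3 * d0 + 2 * dm = m * d0 ->
  cone (sg * d1) (sg * d0) -> cone (- sg * d0) (- sg * dm).
Proof.
  intros Hm E H.
  replace (- sg * d0) with (- (sg * d0)) by ring.
  replace (- sg * dm) with (- (sg * dm)) by ring.
  apply (cone_step m (sg * d1)); [exact Hm| |exact H].
  replace (m * (sg * d0)) with (sg * (m * d0)) by ring.
  rewrite <- E; ring.
Qed.

Lemma cone_bounds (sg x0 x1 u0 u1 : R) :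
  sg = 1 \/ sg = - 1 ->
  cone (sg * u1) (sg * u0) -> cone (sg * (x1 - u1)) (sg * (x0 - u0)) ->
  Rabs u0 <= Rabs x0.
Proof.
  unfold cone; intros [-> | ->] H1 H2.
  - rewrite !Rabs_pos_eq; lra.
  - rewrite !Rabs_left1; lra.
Qed.

(** The inverse of the second iterate is monotone for the order defined by the
    cone. The divided differences of [cubic lam] between 0 and [u0], and between
    [u0] and [x0], are at most 1/25 in absolute value, since both points are
    within 1/200 of the origin. *)
Lemma cone_order_step (lam sg x0 x1 u1 u0 um : R) :
  0 <= lam <= 1 / 10000 -> sg = 1 \/ sg = - 1 -> Rabs x0 <= 1 / 200 ->
  cubic lam x0 = 3 * (x0 + x1) -> u1 + 3 * u0 + 2 * um = cubic lam u0 ->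
  cone (sg * u1) (sg * u0) -> cone (sg * (x1 - u1)) (sg * (x0 - u0)) ->
  cone (- sg * u0) (- sg * um) /\ cone (- sg * (x0 - u0)) (- sg * (x1 - um)).
Proof.
  intros Hl Hsg H0 Hx Hu C1 C2.
  assert (Hb := cone_bounds _ _ _ _ _ Hsg C1 C2).
  assert (Hu0 : Rabs u0 <= 1 / 200) by lra.
  apply Rabs_le_between in H0; apply Rabs_le_between in Hu0.
  unfold cubic in *; split.
  - apply (cone_neg_step sg (u0 ^ 2 - 3 * u0 - lam) u1); [| |exact C1].
    + apply Rabs_le; nra.
    + rewrite Hu; ring.
  - apply (cone_neg_step sg (x0 ^ 2 + x0 * u0 + u0 ^ 2 - 3 * (x0 + u0) - lam)
                         (x1 - u1)); [| |exact C2].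
    + apply Rabs_le; nra.
    + replace (x1 - u1 + 3 * (x0 - u0) + 2 * (x1 - um))
        with (3 * (x0 + x1) - (u1 + 3 * u0 + 2 * um)) by ring.
      rewrite <- Hx, Hu; ring.
Qed.

(** The deviation of the height of [state u0 um] from [- 2 u0 ^ 2 - 2 lam u0],
    the height of the invariant curve to leading order. *)
Definition graph_defect (lam u0 um : R) : R :=
  2 * (u0 + um) + 2 * u0 ^ 2 + 2 * lam * u0.

Definition near_graph (lam u0 um : R) : Prop :=
  Rabs (graph_defect lam u0 um) <= 10 * (Rabs u0 * (Rabs u0 + lam) ^ 2).

(** With [g = u0 + u1] the recurrence gives
    [e0 = u0 ^ 3 - 2 g u0 + g ^ 2 + lam g - e1 / 2] for consecutive defects. The
    factor 1/2 makes the estimate contract, and [g], half the height of the next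
    point, is itself of second order. The constant 10 leaves room for all
    terms: they add up to less than 9.2. *)
Lemma near_graph_step (lam sg u1 u0 um : R) :
  0 <= lam <= 1 / 10000 -> sg = 1 \/ sg = - 1 -> Rabs u0 <= 1 / 200 ->
  u1 + 3 * u0 + 2 * um = cubic lam u0 ->
  cone (sg * u1) (sg * u0) ->
  near_graph lam u1 u0 -> near_graph lam u0 um.
Proof.
  unfold near_graph; intros Hl Hsg Hb Hu C H.
  assert (HT : 19 / 20 * Rabs u1 <= Rabs u0).
  { unfold cone in C; destruct Hsg as [-> | ->].
    - rewrite (Rabs_left1 u1), (Rabs_pos_eq u0); lra.
    - rewrite (Rabs_left1 u0), (Rabs_pos_eq u1); lra. }
  assert (P0 := Rabs_pos u0); assert (P1 := Rabs_pos u1).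
  assert (HT' : Rabs u1 <= 20 / 19 * Rabs u0) by lra; clear HT C Hsg.
  set (T := Rabs u0) in *; set (T1 := Rabs u1) in *.
  set (e1 := graph_defect lam u1 u0) in *; set (e0 := graph_defect lam u0 um).
  set (g := u0 + u1).
  set (K := T + lam).
  assert (HK : 0 <= K <= 51 / 10000) by (unfold K; lra).
  assert (HK1 : 0 <= T1 + lam <= 20 / 19 * K) by (unfold K; lra).
  assert (HTK : 0 <= T * K) by nra.
  assert (HM : T1 * (T1 + lam) <= (20 / 19) ^ 2 * (T * K)).
  { replace ((20 / 19) ^ 2 * (T * K)) with ((20 / 19 * T) * (20 / 19 * K)) by ring.
    apply Rmult_le_compat; lra. }
  assert (HM0 : 0 <= T1 * (T1 + lam)) by nra.
  assert (HTK2' : 0 <= T * K ^ 2) by (apply Rmult_le_pos; [lra|apply pow2_ge_0]).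
  assert (HM2 : T1 * (T1 + lam) ^ 2 <= 117 / 100 * (T * K ^ 2)).
  { apply Rle_trans with ((20 / 19) ^ 3 * (T * K ^ 2)); [|lra].
    replace (T1 * (T1 + lam) ^ 2) with (T1 * (T1 + lam) * (T1 + lam)) by ring.
    replace ((20 / 19) ^ 3 * (T * K ^ 2))
      with ((20 / 19) ^ 2 * (T * K) * (20 / 19 * K)) by ring.
    apply Rmult_le_compat; lra. }
  assert (HE1 : Rabs e1 <= 117 / 10 * (T * K ^ 2)) by lra.
  assert (HTK2 : T * K ^ 2 <= 51 / 10000 * (T * K)).
  { replace (T * K ^ 2) with (K * (T * K)) by ring.
    apply Rmult_le_compat_r; lra. }
  assert (Hg : Rabs g <= 115 / 100 * (T * K)).
  { assert (A1 : Rabs (u1 ^ 2 + lam * u1) <= T1 * (T1 + lam)).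
    { eapply Rle_trans; [apply Rabs_triang|].
      rewrite Rabs_mult, <- RPow_abs, (Rabs_pos_eq lam) by lra; fold T1; lra. }
    replace g with (e1 / 2 + - (u1 ^ 2 + lam * u1))
      by (unfold e1, g, graph_defect; field).
    eapply Rle_trans; [apply Rabs_triang|]; rewrite Rabs_Ropp.
    unfold Rdiv at 1; rewrite Rabs_mult, (Rabs_pos_eq (/ 2)) by lra.
    lra. }
  assert (E0 : e0 = u0 ^ 3 - 2 * g * u0 + g ^ 2 + lam * g - e1 / 2).
  { unfold e0, graph_defect.
    replace (2 * (u0 + um)) with (cubic lam u0 - (u0 + u1)) by lra.
    unfold e1, graph_defect, g, cubic; field. }
  assert (B1 : Rabs (u0 ^ 3) <= T * T ^ 2).
  { rewrite <- RPow_abs; fold T; lra. }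
  assert (B2 : Rabs (2 * g * u0) <= 230 / 100 * (T * (T * K))).
  { rewrite !Rabs_mult, (Rabs_pos_eq 2) by lra; fold T.
    assert (Rabs g * T <= 115 / 100 * (T * K) * T)
      by (apply Rmult_le_compat_r; lra). lra. }
  assert (B3 : Rabs (g ^ 2) <= 2 / 100 * (T * K ^ 2)).
  { rewrite <- RPow_abs.
    assert (Rabs g ^ 2 <= (115 / 100 * (T * K)) ^ 2)
      by (apply pow_incr; split; [apply Rabs_pos | lra]).
    assert (T * (T * K ^ 2) <= 1 / 200 * (T * K ^ 2))
      by (apply Rmult_le_compat_r; lra). lra. }
  assert (B4 : Rabs (lam * g) <= 115 / 100 * (T * (lam * K))).
  { rewrite Rabs_mult, (Rabs_pos_eq lam) by lra.
    assert (lam * Rabs g <= lam * (115 / 100 * (T * K)))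
      by (apply Rmult_le_compat_l; lra). lra. }
  assert (B5 : Rabs (e1 / 2) <= 585 / 100 * (T * K ^ 2)).
  { unfold Rdiv at 1; rewrite Rabs_mult, (Rabs_pos_eq (/ 2)) by lra; lra. }
  assert (B6 : T * T ^ 2 <= T * K ^ 2)
    by (apply Rmult_le_compat_l; [lra|apply pow_incr; unfold K; lra]).
  assert (B7 : T * (T * K) + T * (lam * K) = T * K ^ 2) by (unfold K; ring).
  assert (B8 : 0 <= T * (lam * K)) by (apply Rmult_le_pos; nra).
  rewrite E0.
  apply Rabs_le.
  apply Rabs_le_between in B1; apply Rabs_le_between in B2.
  apply Rabs_le_between in B3; apply Rabs_le_between in B4.
  apply Rabs_le_between in B5.
  lra.
Qed.

(** * Propagation along the stable manifold *)

(** Backward iteration multiplies [t] by [- r], so a property that holds near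
    the origin and is inherited by preimages holds on the whole manifold. *)
Lemma expansion_ind (r : R) (P : R -> Prop) (d : R) :
  1 < r -> 0 < d ->
  (forall t, t <> 0 -> Rabs t < d -> P t) ->
  (forall t, t <> 0 -> P t -> P (- r * t)) ->
  forall t, t <> 0 -> P t.
Proof.
  intros Hr Hd Hbase Hstep t Ht.
  assert (Hn : forall n t, t <> 0 -> P t -> P ((- r) ^ n * t)).
  { induction n as [|n IH]; intros x Hx Px.
    - simpl; rewrite Rmult_1_l; exact Px.
    - replace ((- r) ^ S n * x) with ((- r) ^ n * (- r * x)) by (simpl; ring).
      apply IH; [nra|apply Hstep; assumption]. }
  assert (Hir : Rabs (- / r) < 1).
  { rewrite Rabs_Ropp, Rabs_pos_eq by (apply Rlt_le, Rinv_0_lt_compat; lra).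
    rewrite <- Rinv_1; apply Rinv_lt_contravar; lra. }
  assert (HT : 0 < Rabs t) by (apply Rabs_pos_lt, Ht).
  destruct (pow_lt_1_zero (- / r) Hir (d / Rabs t)) as [N HN];
    [apply Rdiv_lt_0_compat; assumption|].
  specialize (HN N (le_n _)).
  assert (E : (- r) ^ N * ((- / r) ^ N * t) = t).
  { rewrite <- Rmult_assoc, <- Rpow_mult_distr.
    replace (- r * - / r) with 1 by (field; lra).
    rewrite pow1; ring. }
  rewrite <- E; apply Hn.
  - intros Z; rewrite Z, Rmult_0_r in E; auto.
  - apply Hbase; [intros Z; rewrite Z, Rmult_0_r in E; auto|].
    rewrite Rabs_mult.
    apply Rmult_lt_reg_r with (/ Rabs t); [apply Rinv_0_lt_compat, HT|].
    replace (Rabs ((- / r) ^ N) * Rabs t * / Rabs t)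
      with (Rabs ((- / r) ^ N)) by (field; lra).
    exact HN.
Qed.

Lemma continuous_near (f : R -> R) (e : R) :
  continuous f 0 -> 0 < e ->
  exists d, 0 < d /\ forall t, Rabs t < d -> Rabs (f t - f 0) < e.
Proof.
  intros Hf He.
  destruct (proj1 (filterlim_locally _ _) Hf (mkposreal e He)) as [d Hd].
  exists d; split; [apply cond_pos|]; intros t Ht.
  apply (Hd t); change (Rabs (t - 0) < d); rewrite Rminus_0_r; exact Ht.
Qed.

(** The ratio [- / r] of the linearized recurrence lies well inside the cone. *)
Lemma cone_near (r l x0 x1 : R) :
  1 < r <= 101 / 100 -> 0 < l ->
  Rabs (x0 - l) <= l / 200 -> Rabs (x1 - l) <= l / 200 ->
  cone (- / r * x1) x0.
Proof.
  intros Hr Hl H0 H1.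
  apply Rabs_le_between in H0; apply Rabs_le_between in H1.
  assert (Hi : 100 / 101 <= / r <= 1).
  { split.
    - replace (100 / 101) with (/ (101 / 100)) by field.
      apply Rinv_le_contravar; lra.
    - rewrite <- Rinv_1; apply Rinv_le_contravar; lra. }
  assert (H2 : 100 / 101 * x1 <= / r * x1) by (apply Rmult_le_compat_r; lra).
  assert (H3 : / r * x1 <= 1 * x1) by (apply Rmult_le_compat_r; lra).
  unfold cone; lra.
Qed.

(** In the order of the cone the point with parameter [t] lies between the
    origin and the point of the cycle with current value [x0] and next value
    [x1]; the sign [sg] distinguishes the two branches. *)
Definition between_cycle (s : R -> R) (r sg x0 x1 t : R) : Prop :=
  cone (sg * s (- / r * t)) (sg * s t) /\
  cone (sg * (x1 - s (- / r * t))) (sg * (x0 - s t)).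

(** All properties hold near the origin, by continuity and because the
    inequalities between the multipliers are strict, and they pass from [t] to
    [- r t] by the cone steps; the two branches are exchanged each time. The
    derivative of [s] obeys the linearized recurrence, which is the step of the
    cone with the slope in place of a divided difference. *)
Lemma branch_invariants (lam r a b : R) (s S s' : R -> R) :
  0 < lam <= 1 / 10000 -> stable_branch lam r s S s' ->
  two_cycle lam a b -> b < 0 -> - (96 / 100) * b <= a <= - (104 / 100) * b ->
  Rabs a <= 1 / 200 -> Rabs b <= 1 / 200 ->
  forall t, t <> 0 ->
    ((0 < t -> between_cycle s r 1 a b t) /\
     (t < 0 -> between_cycle s r (- 1) b a t)) /\
    near_graph lam (s t) (s (- r * t)) /\
    cone (- / r * s' (- / r * t)) (s' t).
Proof.
  intros Hl SB Hc Hb Ha Hab Hbb.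
  destruct SB as [Hr Htr Hfac Hrec _ Hder HcS HpS Hcs Hps].
  destruct Hc as (_ & Ca & Cb).
  assert (Hi : 0 < / r < 1).
  { split; [apply Rinv_0_lt_compat; lra|].
    rewrite <- Rinv_1; apply Rinv_lt_contravar; lra. }
  assert (Hback : forall t, - / r * (- r * t) = t) by (intros; field; lra).
  set (l := S 0) in *.
  assert (Hl2 : 0 < lam ^ 2 <= 1 / 10000 * lam)
    by (split; [apply pow_lt; lra|];
        simpl; rewrite Rmult_1_r; apply Rmult_le_compat_r; lra).
  assert (He : 0 < l * (lam ^ 2 / 10)) by (apply Rmult_lt_0_compat; lra).
  destruct (continuous_near S _ HcS He) as (d1 & Hd1 & H1); fold l in H1.
  destruct (continuous_near s' (s' 0 / 200) Hcs ltac:(lra)) as (d2 & Hd2 & H2).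
  (* The halving of [d1] allows for the argument [- r t]; the bound
     [lam ^ 2 / 100] keeps the quadratic terms of the defect within the allowed
     multiple of [lam ^ 2 * s t], and [- b / 1000] leaves the differences to the
     cycle inside the cone. *)
  set (d := Rmin (Rmin (d1 / 2) d2) (Rmin (lam ^ 2 / 100) (- b / 1000) / l)).
  assert (Hd3 : 0 < Rmin (lam ^ 2 / 100) (- b / 1000)) by (apply Rmin_pos; lra).
  assert (Hd : 0 < d).
  { repeat apply Rmin_pos; try lra; apply Rdiv_lt_0_compat; assumption. }
  intros t0 Ht0; pattern t0; revert t0 Ht0.
  apply (expansion_ind r _ d); [lra|exact Hd| |].
  - intros t Ht0 Ht.
    assert (Ht1 : Rabs t < d1 / 2).
    { apply Rlt_le_trans with (1 := Ht); unfold d.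
      eapply Rle_trans; apply Rmin_l. }
    assert (Ht2 : Rabs t < d2).
    { apply Rlt_le_trans with (1 := Ht); unfold d.
      eapply Rle_trans; [apply Rmin_l|apply Rmin_r]. }
    assert (Ht3 : Rabs t * l < Rmin (lam ^ 2 / 100) (- b / 1000)).
    { apply Rmult_lt_reg_r with (/ l); [apply Rinv_0_lt_compat; lra|].
      replace (Rabs t * l * / l) with (Rabs t) by (field; lra).
      apply Rlt_le_trans with (1 := Ht); apply Rmin_r. }
    assert (Ht4 := Rlt_le_trans _ _ _ Ht3 (Rmin_l _ _)).
    assert (Ht5 := Rlt_le_trans _ _ _ Ht3 (Rmin_r _ _)).
    assert (HTp := Rabs_pos t).
    assert (Hti : Rabs (- / r * t) <= Rabs t).
    { rewrite Rabs_mult, Rabs_Ropp, Rabs_pos_eq by lra.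
      rewrite <- (Rmult_1_l (Rabs t)) at 2; apply Rmult_le_compat_r; lra. }
    assert (Htr' : Rabs (- r * t) < d1).
    { rewrite Rabs_mult, Rabs_Ropp, Rabs_pos_eq by lra. nra. }
    assert (A0 := H1 t ltac:(lra)).
    assert (A1 := H1 (- / r * t) ltac:(lra)).
    assert (A2 := H1 (- r * t) Htr').
    assert (Hsm : l * (lam ^ 2 / 10) <= l / 200).
    { replace (l / 200) with (l * (1 / 200)) by field.
      apply Rmult_le_compat_l; lra. }
    assert (C0 : cone (- / r * S (- / r * t)) (S t))
      by (apply cone_near with l; lra).
    assert (Hs0 : Rabs (s t) <= - b / 900).
    { rewrite Hfac, Rabs_mult.
      assert (Rabs (S t) <= 201 / 200 * l)
        by (apply Rabs_le; apply Rabs_def2 in A0; lra).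
      assert (Rabs t * Rabs (S t) <= Rabs t * (201 / 200 * l))
        by (apply Rmult_le_compat_l; lra). lra. }
    assert (Hs1 : Rabs (s (- / r * t)) <= - b / 900).
    { rewrite Hfac, Rabs_mult.
      assert (Rabs (S (- / r * t)) <= 201 / 200 * l)
        by (apply Rabs_le; apply Rabs_def2 in A1; lra).
      assert (Rabs (- / r * t) * Rabs (S (- / r * t)) <= Rabs t * (201 / 200 * l))
        by (apply Rmult_le_compat; try apply Rabs_pos; lra). lra. }
    apply Rabs_le_between in Hs0; apply Rabs_le_between in Hs1.
    split; [split|split].
    + intros Hp; split.
      * rewrite !Hfac, !Rmult_1_l.
        replace (- / r * t * S (- / r * t)) with (t * (- / r * S (- / r * t))) by ring.
        apply cone_scale; assumption.
      * unfold cone; lra.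
    + intros Hn; split.
      * rewrite !Hfac.
        replace (-1 * (- / r * t * S (- / r * t)))
          with ((- t) * (- / r * S (- / r * t))) by ring.
        replace (-1 * (t * S t)) with (- t * S t) by ring.
        apply cone_scale; [lra|assumption].
      * unfold cone; lra.
    + unfold near_graph, graph_defect.
      rewrite (Hfac (- r * t)), (Hfac t).
      set (u := S t) in *; set (v := S (- r * t)) in *.
      apply Rabs_def2 in A0; apply Rabs_def2 in A2.
      assert (Hu : 0 < u) by lra.
      replace (2 * (t * u + - r * t * v) + 2 * (t * u) ^ 2 + 2 * lam * (t * u))
        with (t * (2 * (u - r * v) + 2 * (t * u) * u + 2 * lam * u)) by ring.
      rewrite (Rabs_mult t u), Rabs_mult, (Rabs_pos_eq u) by lra.
      assert (Hk : Rabs (2 * (u - r * v) + 2 * (t * u) * u + 2 * lam * u)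
                   <= 10 * (u * lam ^ 2)).
      { rewrite Hfac in Hs0.
        assert (Htu : Rabs (t * u) <= lam ^ 2 / 90).
        { rewrite Rabs_mult, (Rabs_pos_eq u) by lra.
          assert (Rabs t * u <= Rabs t * (201 / 200 * l))
            by (apply Rmult_le_compat_l; lra). lra. }
        apply Rabs_le_between in Htu.
        apply Rabs_le_between in Htr.
        assert (Hz : - (l * lam ^ 2 / 10) <= v - u + (u - l) <= l * lam ^ 2 / 10) by lra.
        replace (2 * (u - r * v) + 2 * (t * u) * u + 2 * lam * u)
          with (2 * (lam - (r - 1)) * u + 2 * (t * u) * u + 2 * r * (u - v)) by ring.
        assert (K1 : - (4 * lam ^ 2) * u <= (lam - (r - 1)) * u <= 4 * lam ^ 2 * u)
          by (split; apply Rmult_le_compat_r; lra).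
        assert (K2 : - (lam ^ 2 / 90) * u <= t * u * u <= lam ^ 2 / 90 * u)
          by (split; apply Rmult_le_compat_r; lra).
        assert (Huv : - (l * lam ^ 2 / 5) <= u - v <= l * lam ^ 2 / 5) by lra.
        assert (K3 : - (r * (l * lam ^ 2 / 5)) <= r * (u - v) <= r * (l * lam ^ 2 / 5))
          by nra.
        assert (Hll : 0 < l * lam ^ 2) by lra.
        assert (K4 : r * (l * lam ^ 2 / 5) <= 101 / 100 * (l * lam ^ 2 / 5))
          by (apply Rmult_le_compat_r; lra).
        assert (K5 : 199 / 200 * (l * lam ^ 2) <= u * lam ^ 2).
        { rewrite <- Rmult_assoc; apply Rmult_le_compat_r; lra. }
        apply Rabs_le; lra. }
      apply Rle_trans with (Rabs t * (10 * (u * lam ^ 2)));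
        [apply Rmult_le_compat_l; assumption|].
      replace (Rabs t * (10 * (u * lam ^ 2))) with (10 * (Rabs t * u * lam ^ 2)) by ring.
      apply Rmult_le_compat_l; [lra|].
      assert (0 <= Rabs t * u) by (apply Rmult_le_pos; lra).
      apply Rmult_le_compat_l; [lra|apply pow_incr; lra].
    + apply cone_near with (s' 0); try lra.
      * apply Rlt_le, H2; lra.
      * apply Rlt_le, H2; lra.
  - intros t Ht ((Bp & Bn) & Hg & Hc').
    assert (Hstep : forall sg x0 x1, sg = 1 \/ sg = - 1 ->
       Rabs x0 <= 1 / 200 -> Rabs x1 <= 1 / 200 ->
       cubic lam x0 = 3 * (x0 + x1) ->
       between_cycle s r sg x0 x1 t ->
       between_cycle s r (- sg) x1 x0 (- r * t) /\
       near_graph lam (s (- r * t)) (s (- r * (- r * t))) /\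
       Rabs (s t) <= 1 / 200).
    { intros sg x0 x1 Hsg B0 B1 Hx [C1 C2].
      assert (Hbd := cone_bounds _ _ _ _ _ Hsg C1 C2).
      destruct (cone_order_step lam sg x0 x1 (s (- / r * t)) (s t) (s (- r * t)))
        as [C3 C4]; auto; [lra|].
      assert (Hsg' : - sg = 1 \/ - sg = - 1) by (destruct Hsg; lra).
      assert (Hbd' := cone_bounds _ _ _ _ _ Hsg' C3 C4).
      split; [split; rewrite Hback; assumption|split; [|lra]].
      apply (near_graph_step lam (- sg) (s t)); auto; try lra.
      assert (R1 := Hrec (- r * t)); rewrite Hback in R1; exact R1. }
    assert (Hsum : between_cycle s r 1 a b t \/ between_cycle s r (- 1) b a t)
      by (destruct (Rtotal_order t 0) as [|[|]]; [right|contradiction|left]; auto).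
    assert (Hall : near_graph lam (s (- r * t)) (s (- r * (- r * t))) /\
                   Rabs (s t) <= 1 / 200).
    { destruct Hsum as [B|B]; apply Hstep in B; auto; [tauto|tauto|lra]. }
    destruct Hall as [Hg' Hst].
    split; [split|split; [exact Hg'|]].
    + intros Hp; assert (Hn : t < 0) by nra.
      apply Bn in Hn; apply Hstep in Hn; auto; [|lra].
      replace 1 with (- - 1) by ring; tauto.
    + intros Hn; assert (Hp : 0 < t) by nra.
      apply Bp in Hp; apply Hstep in Hp; auto; tauto.
    + assert (Hd' : - / r * s' (- / r * t) + 3 * s' t + 2 * (- r * s' (- r * t))
                    = (3 * s t ^ 2 - 6 * s t - lam) * s' t).
      { assert (D1 : is_derive (fun t => s (- / r * t) + 3 * s t + 2 * s (- r * t)) t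
                  (- / r * s' (- / r * t) + 3 * s' t + 2 * (- r * s' (- r * t)))).
        { auto_derive.
          - repeat split; eexists; apply Hder.
          - rewrite !(is_derive_unique _ _ _ (Hder _)); ring. }
        assert (D2 : is_derive (fun t => cubic lam (s t)) t
                  ((3 * s t ^ 2 - 6 * s t - lam) * s' t)).
        { unfold cubic; auto_derive.
          - repeat split; eexists; apply Hder.
          - rewrite !(is_derive_unique _ _ _ (Hder _)); ring. }
        apply (is_derive_ext _ _ _ _ Hrec) in D1.
        rewrite <- (is_derive_unique _ _ _ D1); apply is_derive_unique, D2. }
      assert (Hm : Rabs (3 * s t ^ 2 - 6 * s t - lam) <= 1 / 25)
        by (apply Rabs_le_between in Hst; apply Rabs_le; nra).
      apply (cone_step _ _ _ _ Hm Hd') in Hc'.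
      rewrite Hback.
      apply (cone_scale (/ r)) in Hc'; [|lra].
      replace (/ r * - (- r * s' (- r * t))) with (s' (- r * t)) in Hc' by (field; lra).
      replace (- / r * s' t) with (/ r * - s' t) by ring.
      exact Hc'.
Qed.

(** * Convergence to the two-cycle *)

(** Convergence at [+oo], with a positive threshold for later use with powers of
    [r]. *)
Definition tends (f : R -> R) (l : R) : Prop :=
  forall e, 0 < e -> exists T, 0 < T /\ forall t, T < t -> Rabs (f t - l) < e.

Lemma increasing_tends (f : R -> R) (M : R) :
  (forall x y, x < y -> f x < f y) -> (forall t, f t <= M) ->
  exists l, (forall t, f t < l) /\ tends f l.
Proof.
  intros Hinc HM.
  destruct (completeness (fun y => exists t, y = f t)) as [l [Hub Hlub]].
  - exists M; intros y [t ->]; apply HM.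
  - exists (f 0), 0; reflexivity.
  - assert (Hlt : forall t, f t < l).
    { intros t; apply Rlt_le_trans with (f (t + 1)); [apply Hinc; lra|].
      apply Hub; eexists; reflexivity. }
    exists l; split; [exact Hlt|]; intros e He.
    assert (Hex : exists t, l - e < f t).
    { apply NNPP; intros Hn.
      assert (l <= l - e); [|lra].
      apply Hlub; intros y [t ->]; apply Rnot_lt_le; intros Hy; apply Hn.
      exists t; exact Hy. }
    destruct Hex as [t Ht]; exists (Rmax t 1); split.
    + apply Rlt_le_trans with 1; [lra|apply Rmax_r].
    + intros u Hu; assert (t < u) by (apply Rle_lt_trans with (2 := Hu), Rmax_l).
      specialize (Hinc t u ltac:(assumption)); specialize (Hlt u).
      apply Rabs_def1; lra.
Qed.

Lemma tends_seq (f : R -> R) (l c : R) :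
  0 < c -> tends f l -> is_lim_seq (fun n => f (c * INR n)) l.
Proof.
  intros Hc Hf; apply is_lim_seq_spec; intros e.
  destruct (Hf e (cond_pos e)) as (T & HT & HTf).
  destruct (nfloor_ex (T / c)) as [N HN];
    [apply Rlt_le, Rdiv_lt_0_compat; assumption|].
  exists (S N); intros n Hn; apply HTf.
  apply le_INR in Hn; rewrite S_INR in Hn.
  apply Rmult_lt_reg_r with (/ c); [apply Rinv_0_lt_compat, Hc|].
  replace (c * INR n * / c) with (INR n) by (field; lra).
  unfold Rdiv in HN; lra.
Qed.

(** Meant for the two branches of the manifold as [f] and [g], each with the
    parameter taken positive. *)
Lemma limit_relation (lam r : R) (f g : R -> R) (l m : R) :
  0 < r -> tends f l -> tends g m ->
  (forall t, g (/ r * t) + 3 * f t + 2 * g (r * t) = cubic lam (f t)) ->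
  cubic lam l = 3 * (l + m).
Proof.
  intros Hr Hf Hg Hrec.
  assert (Hi : 0 < / r) by (apply Rinv_0_lt_compat, Hr).
  assert (L0 := tends_seq f l 1 ltac:(lra) Hf).
  assert (L1 := tends_seq g m _ Hi Hg).
  assert (L2 := tends_seq g m _ Hr Hg).
  assert (A1 : is_lim_seq (fun n => cubic lam (f (1 * INR n))) (m + 3 * l + 2 * m)).
  { apply is_lim_seq_ext
      with (fun n => g (/ r * INR n) + 3 * f (1 * INR n) + 2 * g (r * INR n)).
    - intros n; rewrite Rmult_1_l; apply Hrec.
    - apply is_lim_seq_plus'; [apply is_lim_seq_plus'|]; [exact L1| |];
        apply (is_lim_seq_scal_l _ _ (Finite _)); assumption. }
  assert (A2 : is_lim_seq (fun n => cubic lam (f (1 * INR n))) (cubic lam l)).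
  { apply is_lim_seq_continuous; [|exact L0].
    apply continuity_pt_filterlim, (ex_derive_continuous (cubic lam)).
    unfold cubic; auto_derive; trivial. }
  apply is_lim_seq_unique in A1; apply is_lim_seq_unique in A2.
  rewrite A1 in A2; injection A2; lra.
Qed.

Record connecting_branch (lam r a b : R) (s : R -> R) : Prop := {
  cb_rate : 1 < r;
  cb_zero : s 0 = 0;
  cb_rec : forall t, s (- / r * t) + 3 * s t + 2 * s (- r * t) = cubic lam (s t);
  cb_smooth : forall n t, ex_derive_n s n t;
  cb_deriv : forall t, 0 < Derive s t;
  cb_incr : forall x y, x < y -> s x < s y;
  cb_pos : forall t, 0 < t -> between_cycle s r 1 a b t;
  cb_neg : forall t, t < 0 -> between_cycle s r (- 1) b a t;
  cb_graph : forall t, t <> 0 -> near_graph lam (s t) (s (- r * t));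
  cb_forth : tends s a;
  cb_back : tends (fun t => s (- t)) b
}.

(** The function [s] increases and is bounded by [a] and [b]. Its limits at
    both ends satisfy the relations of a two-cycle and have opposite signs; since
    there is only one two-cycle, they are [a] and [b]. *)
Lemma connecting_branch_exists (lam a b : R) :
  0 < lam <= 1 / 10000 -> two_cycle lam a b -> a + b <= 0 ->
  b < 0 -> - (96 / 100) * b <= a <= - (104 / 100) * b ->
  Rabs a <= 1 / 200 -> Rabs b <= 1 / 200 ->
  exists r s, connecting_branch lam r a b s.
Proof.
  intros Hl Hc Hs Hb Ha Hab Hbb.
  destruct (stable_branch_exists lam Hl) as (r & s & S & s' & SB).
  assert (Hinv := branch_invariants lam r a b s S s' Hl SB Hc Hb Ha Hab Hbb).
  destruct SB as [Hr _ Hfac Hrec Hsm Hder _ _ _ Hps].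
  assert (Hs0 : s 0 = 0) by (rewrite Hfac; ring).
  assert (Hi : 0 < / r) by (apply Rinv_0_lt_compat; lra).
  assert (Hs' : forall t, 0 < s' t).
  { intros t; destruct (Req_dec t 0) as [->|Ht]; [exact Hps|].
    destruct (Hinv t Ht) as (_ & _ & C); unfold cone in C; lra. }
  assert (Hinc : forall x y, x < y -> s x < s y).
  { intros x y Hxy.
    destruct (MVT_gen s x y s') as (c & _ & E).
    - intros; apply Hder.
    - intros z _; apply derivable_continuous_pt; exists (s' z).
      apply is_derive_Reals, Hder.
    - specialize (Hs' c); nra. }
  assert (Hup : forall t, s t <= a).
  { intros t; destruct (Rlt_or_le 0 t) as [Ht|Ht].
    - destruct (Hinv t ltac:(lra)) as ((B & _) & _).
      destruct (B Ht) as [_ C]; unfold cone in C; lra.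
    - assert (s t <= 0); [|lra].
      destruct Ht as [Ht| ->]; [rewrite <- Hs0; apply Rlt_le, Hinc, Ht|lra]. }
  assert (Hdown : forall t, b <= s t).
  { intros t; destruct (Rlt_or_le t 0) as [Ht|Ht].
    - destruct (Hinv t ltac:(lra)) as ((_ & B) & _).
      destruct (B Ht) as [_ C]; unfold cone in C; lra.
    - assert (0 <= s t); [|lra].
      destruct Ht as [Ht| <-]; [rewrite <- Hs0; apply Rlt_le, Hinc, Ht|lra]. }
  destruct (increasing_tends s a Hinc Hup) as (l & Hl1 & Hl2).
  destruct (increasing_tends (fun t => - s (- t)) (- b)) as (m & Hm1 & Hm2).
  { intros x y Hxy; assert (s (- y) < s (- x)) by (apply Hinc; lra); lra. }
  { intros t; specialize (Hdown (- t)); lra. }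
  assert (Hm3 : tends (fun t => s (- t)) (- m)).
  { intros e He; destruct (Hm2 e He) as (T & HT & HTm); exists T; split; [exact HT|].
    intros t Ht; specialize (HTm t Ht).
    replace (s (- t) - - m) with (- (- s (- t) - m)) by ring.
    rewrite Rabs_Ropp; exact HTm. }
  assert (H0l := Hl1 0); assert (H0m := Hm1 0).
  rewrite Ropp_0, Hs0 in H0m; rewrite Hs0 in H0l.
  assert (Hlm : two_cycle lam l (- m)).
  { repeat split; [lra| |].
    - apply (limit_relation lam r s (fun t => s (- t))); auto; [lra|].
      intros t; rewrite <- Hrec.
      replace (- (/ r * t)) with (- / r * t) by ring.
      replace (- (r * t)) with (- r * t) by ring; reflexivity.
    - rewrite (Rplus_comm l); apply (limit_relation lam r (fun t => s (- t)) s);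
        auto; [lra|].
      intros t; rewrite <- Hrec.
      replace (/ r * t) with (- / r * - t) by ring.
      replace (r * t) with (- r * - t) by ring; reflexivity. }
  destruct (two_cycle_unique lam a b l (- m) ltac:(lra) Hs Hc Hlm)
    as [[E1 E2]|[E1 E2]]; [|lra].
  rewrite E1 in Hl2; rewrite E2 in Hm3.
  exists r, s; constructor; auto; try lra.
  - intros t; rewrite (is_derive_unique _ _ _ (Hder t)); apply Hs'.
  - intros t Ht; apply (Hinv t); lra.
  - intros t Ht; apply (Hinv t); lra.
  - intros t Ht; apply (Hinv t Ht).
Qed.

(** * The manifold of heteroclinic orbits *)

Definition branch_point (r : R) (s : R -> R) (t : R) : R * R :=
  state (s t) (s (- r * t)).

(** The stable manifold of the origin without the origin itself, which is not
    asymptotic to the two-cycle. *)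
Definition branch_set (r : R) (s : R -> R) (z : R * R) : Prop :=
  exists t, t <> 0 /\ z = branch_point r s t.

Lemma branch_point_sum (r : R) (s : R -> R) (t : R) :
  fst (branch_point r s t) + snd (branch_point r s t) = s t.
Proof. unfold branch_point, state; simpl; ring. Qed.

Lemma F_branch_point (lam r a b : R) (s : R -> R) (t : R) :
  connecting_branch lam r a b s ->
  F lam (branch_point r s t) = branch_point r s (- / r * t).
Proof.
  intros CB; assert (Hr := cb_rate _ _ _ _ _ CB).
  unfold branch_point; rewrite F_state, <- (cb_rec _ _ _ _ _ CB).
  replace (- r * (- / r * t)) with t by (field; lra).
  f_equal; ring.
Qed.

(** The supremum of the sublevel sets provides the inverse. *)
Lemma increasing_inverse (s : R -> R) :
  (forall x y, x < y -> s x < s y) -> exists g : R -> R, forall t, g (s t) = t.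
Proof.
  intros Hinc; exists (fun y => real (Lub_Rbar (fun t => s t <= y))); intros t.
  replace (Lub_Rbar (fun u => s u <= s t)) with (Finite t); [reflexivity|].
  symmetry; apply is_lub_Rbar_unique; split.
  - intros u Hu; simpl; apply Rnot_lt_le; intros Htu.
    specialize (Hinc t u Htu); lra.
  - intros x Hx; apply Hx; lra.
Qed.

Lemma open_strip (x y : R) : open (fun w : R * R => x < fst w + snd w < y).
Proof.
  apply (open_comp (fun w : R * R => fst w + snd w) (fun v => x < v < y)).
  - intros w _; apply (continuous_plus (fun u : R * R => fst u) (fun u => snd u));
      [apply continuous_fst|apply continuous_snd].
  - apply open_and; [apply open_gt|apply open_lt].
Qed.

(** The sum of the coordinates recovers [s t], so the manifold is a graph over
    the diagonal direction: [s] is strictly increasing, and its inverse is the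
    chart. *)
Lemma branch_manifold (lam r a b : R) (s : R -> R) :
  connecting_branch lam r a b s -> one_dim_manifold (branch_set r s).
Proof.
  intros CB z (t0 & Ht0 & ->).
  assert (Hinc := cb_incr _ _ _ _ _ CB).
  assert (Hsm := cb_smooth _ _ _ _ _ CB).
  assert (Hinj : forall x y, s x < s y -> x < y).
  { intros x y H; apply Rnot_le_lt; intros [Hyx| ->]; [|lra].
    specialize (Hinc y x Hyx); lra. }
  destruct (increasing_inverse s Hinc) as [g Hg].
  set (h := Rabs t0 / 2).
  assert (Hh : 0 < h) by (assert (H := Rabs_pos_lt _ Ht0); unfold h; lra).
  assert (Hnz : forall t, t0 - h < t < t0 + h -> t <> 0).
  { intros t Ht ->; unfold h in Ht.
    destruct (Rcase_abs t0) as [Hn|Hp].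
    - rewrite Rabs_left in Ht; lra.
    - rewrite Rabs_pos_eq in Ht; lra. }
  exists (fun w => s (t0 - h) < fst w + snd w < s (t0 + h)), (t0 - h), (t0 + h),
    (branch_point r s), (fun w => g (fst w + snd w)).
  assert (Hscal : forall n t, ex_derive_n (fun u => s (- r * u)) n t).
  { intros n t; apply ex_derive_n_comp_scal, filter_forall; auto. }
  assert (Hlin : forall c d n t, ex_derive_n (fun u => c * s u + d * s (- r * u)) n t).
  { intros c d n t.
    apply ex_derive_n_plus; apply filter_forall; intros u k _;
      apply ex_derive_n_scal_l; auto. }
  split; [apply open_strip|].
  split; [rewrite branch_point_sum; split; apply Hinc; lra|].
  split; [|split; [|split]].
  - split; intros n t _.
    + apply ex_derive_n_ext with (fun u => - 1 * s u + - 2 * s (- r * u));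
        [intros u; unfold branch_point, state; simpl; ring|apply Hlin].
    + apply ex_derive_n_ext with (fun u => 2 * s u + 2 * s (- r * u));
        [intros u; unfold branch_point, state; simpl; ring|apply Hlin].
  - intros t _ E.
    assert (E1 := f_equal fst E); assert (E2 := f_equal snd E).
    unfold velocity in E1, E2; simpl fst in E1; simpl snd in E2.
    assert (Hd := cb_deriv _ _ _ _ _ CB t).
    assert (Ed : Derive s t = Derive (fun u => fst (branch_point r s u)) t
                            + Derive (fun u => snd (branch_point r s u)) t).
    { rewrite <- Derive_plus.
      - apply Derive_ext; intros u; symmetry; apply branch_point_sum.
      - apply ex_derive_ext with (fun u => - 1 * s u + - 2 * s (- r * u));
          [intros u; unfold branch_point, state; simpl; ring|apply (Hlin _ _ 1%nat)].
      - apply ex_derive_ext with (fun u => 2 * s u + 2 * s (- r * u));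
          [intros u; unfold branch_point, state; simpl; ring|apply (Hlin _ _ 1%nat)]. }
    apply (Rlt_irrefl 0); rewrite Ed in Hd.
    apply Rlt_le_trans with (1 := Hd); apply Req_le.
    transitivity (0 + 0); [f_equal; assumption|ring].
  - intros t Ht; split; [exists t; split; [apply Hnz, Ht|reflexivity]|].
    rewrite branch_point_sum; split; [split; apply Hinc; lra|apply Hg].
  - intros w (t & Ht & ->) HV; rewrite branch_point_sum in *; rewrite Hg.
    split; [split; apply Hinj; lra|]; split; [reflexivity|].
    apply filterlim_locally; intros e.
    assert (Hloc : locally (branch_point r s t)
                     (fun w => s (t - e) < fst w + snd w < s (t + e))).
    { apply open_strip; rewrite branch_point_sum.
      assert (He := cond_pos e); split; apply Hinc; lra. }
    unfold within; revert Hloc; apply filter_imp.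
    intros w Hw [(u & _ & ->) _]; rewrite branch_point_sum in *; rewrite Hg.
    change (Rabs (u - t) < e).
    destruct Hw as [Hw1 Hw2]; apply Hinj in Hw1; apply Hinj in Hw2.
    apply Rabs_def1; lra.
Qed.

Lemma ball_state (u v u' v' e : R) :
  Rabs (u' - u) < e / 4 -> Rabs (v' - v) < e / 4 ->
  ball (state u v) e (state u' v').
Proof.
  intros Hu Hv; apply Rabs_def2 in Hu; apply Rabs_def2 in Hv.
  split.
  - change (Rabs ((- 2 * v' - u') - (- 2 * v - u)) < e); apply Rabs_def1; lra.
  - change (Rabs ((2 * u' + 2 * v') - (2 * u + 2 * v)) < e); apply Rabs_def1; lra.
Qed.

(** On the manifold the map multiplies the parameter by [- / r]: forward
    orbits tend to [t = 0], and along backward orbits the parameter tends to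
    infinity with alternating signs, so that the points approach the two points
    of the cycle in turn. *)
Lemma branch_heteroclinic (lam r a b : R) (s : R -> R) (P : R * R -> Prop) (t : R) :
  connecting_branch lam r a b s -> P (state a b) -> P (state b a) -> t <> 0 ->
  exists u : Z -> R * R,
    u 0%Z = branch_point r s t /\
    (forall n : Z, branch_set r s (u n)) /\
    heteroclinic (F lam) (fun w => w = (0, 0)) P u.
Proof.
  intros CB Pab Pba Ht.
  assert (Hr := cb_rate _ _ _ _ _ CB).
  assert (Hi : 0 < / r < 1).
  { split; [apply Rinv_0_lt_compat; lra|].
    rewrite <- Rinv_1; apply Rinv_lt_contravar; lra. }
  assert (Hmu : - / r <> 0) by lra.
  assert (HT : 0 < Rabs t) by (apply Rabs_pos_lt, Ht).
  exists (fun n => branch_point r s (powerRZ (- / r) n * t)).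
  split; [simpl; rewrite Rmult_1_l; reflexivity|].
  split.
  { intros n; exists (powerRZ (- / r) n * t); split; [|reflexivity].
    apply Rmult_integral_contrapositive_currified; [|exact Ht].
    apply powerRZ_NOR, Hmu. }
  split.
  { intros n; rewrite (F_branch_point _ _ _ _ _ _ CB), powerRZ_add, powerRZ_1 by exact Hmu.
    f_equal; ring. }
  left; split; intros e He.
  - assert (Hcont : continuous s 0).
    { apply (ex_derive_continuous s), (cb_smooth _ _ _ _ _ CB 1%nat). }
    destruct (continuous_near s (e / 4) Hcont ltac:(lra)) as (d & Hd & Hds).
    rewrite (cb_zero _ _ _ _ _ CB) in Hds.
    assert (Hd' : 0 < d / (r * Rabs t))
      by (apply Rdiv_lt_0_compat; [lra|apply Rmult_lt_0_compat; lra]).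
    destruct (pow_lt_1_zero (- / r) ltac:(rewrite Rabs_Ropp, Rabs_pos_eq; lra) _ Hd')
      as [N HN].
    exists N; intros n Hn; exists (0, 0); split; [reflexivity|].
    specialize (HN n Hn); rewrite <- pow_powerRZ.
    set (x := (- / r) ^ n) in *.
    assert (Hx : r * Rabs (x * t) < d).
    { rewrite Rabs_mult.
      apply Rmult_lt_reg_r with (/ (r * Rabs t));
        [apply Rinv_0_lt_compat, Rmult_lt_0_compat; lra|].
      replace (r * (Rabs x * Rabs t) * / (r * Rabs t)) with (Rabs x)
        by (field; split; lra).
      exact HN. }
    replace (0, 0) with (state 0 0) by (unfold state; f_equal; ring).
    apply ball_state; apply Hds.
    + assert (Hp := Rabs_pos (x * t)); nra.
    + rewrite Rabs_mult, Rabs_Ropp, (Rabs_pos_eq r) by lra; exact Hx.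
  - destruct (cb_forth _ _ _ _ _ CB (e / 4) ltac:(lra)) as (T1 & HT1 & L1).
    destruct (cb_back _ _ _ _ _ CB (e / 4) ltac:(lra)) as (T2 & HT2 & L2).
    set (T := Rmax T1 T2).
    assert (HT1' : T1 <= T) by apply Rmax_l.
    assert (HT2' : T2 <= T) by apply Rmax_r.
    destruct (Pow_x_infinity (- r) ltac:(rewrite Rabs_Ropp, Rabs_pos_eq; lra)
                ((T + 1) / Rabs t)) as [N HN].
    exists N; intros n Hn; specialize (HN n Hn).
    assert (Ex : powerRZ (- / r) (- Z.of_nat n) = (- r) ^ n).
    { rewrite powerRZ_neg', <- pow_powerRZ, <- pow_inv.
      f_equal; field; lra. }
    rewrite Ex.
    set (y := (- r) ^ n * t).
    assert (Hy : T < Rabs y).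
    { unfold y; rewrite Rabs_mult.
      apply Rlt_le_trans with (T + 1); [lra|].
      apply Rmult_le_reg_r with (/ Rabs t); [apply Rinv_0_lt_compat, HT|].
      replace (Rabs ((- r) ^ n) * Rabs t * / Rabs t) with (Rabs ((- r) ^ n))
        by (field; lra).
      apply Rge_le, HN. }
    unfold branch_point.
    destruct (Rcase_abs y) as [Hneg|Hpos].
    + rewrite Rabs_left in Hy by exact Hneg.
      exists (state b a); split; [exact Pba|].
      apply ball_state.
      * rewrite <- (Ropp_involutive y); apply L2; lra.
      * apply L1; nra.
    + rewrite Rabs_pos_eq in Hy by lra.
      exists (state a b); split; [exact Pab|].
      apply ball_state.
      * apply L1; lra.
      * replace (- r * y) with (- (r * y)) by ring; apply L2; nra.
Qed.

(** * Estimates for the box *)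

(** To leading order the upper bound of the box is [l' ^ 2 / 2]; with
    [h = sqrt (1 + 12 l') - 1] the difference of the two sides is a
    polynomial in [h] with nonnegative coefficients. *)
Lemma lam_u_plus_bound (lam EK : R) :
  0 <= lam -> 0 <= EK ->
  let l' := (1 + EK) * lam in
  l' ^ 2 / 2 * (1 - 2 * l') <= lam_u_plus lam EK.
Proof.
  intros Hl HE l'.
  unfold lam_u_plus.
  replace (1 + 12 * lam + 12 * EK * lam) with (1 + 12 * l') by (unfold l'; ring).
  assert (Hl' : 0 <= l') by (unfold l'; nra).
  set (q := sqrt (1 + 12 * l')).
  assert (Hq : q * q = 1 + 12 * l') by (apply sqrt_sqrt; lra).
  assert (Hq1 : 1 <= q) by (unfold q; rewrite <- sqrt_1 at 1; apply sqrt_le_1; lra).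
  assert (Hh : 0 <= q - 1) by lra.
  set (h := q - 1) in *.
  replace q with (1 + h) in * by (unfold h; ring); clearbody h.
  replace l' with ((2 * h + h ^ 2) / 12) by lra.
  assert (H : 0 <= h ^ 4 * (3 + 3 * h + h ^ 2 / 2)).
  { apply Rmult_le_pos; [apply pow_le; lra | nra]. }
  lra.
Qed.

(** Here [w] is the square root of [lam]. The parabola
    [- 2 T ^ 2 + 2 w ^ 2 T] has the maximum [w ^ 4 / 2], attained far from the
    cycle, and is about [- w ^ 2 / 2] at the cycle, where [T] is about [w / 2]. The
    remainder changes both values by a factor [1 + O(w)], with a constant smaller
    than the one in the margins of the box. *)
Lemma height_bound (w u y : R) :
  0 < w <= 875 / 100000 ->
  Rabs u <= w / 2 * (1 + w) ->
  Rabs (y + 2 * u ^ 2 + 2 * w ^ 2 * u) <= 10 * (Rabs u * (Rabs u + w ^ 2) ^ 2) ->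
  - (w ^ 2 / 2) * (1 + 57 * w) <= y <= w ^ 4 / 2 * (1 + 60 * w).
Proof.
  intros Hw Hu Hy.
  assert (P0 := Rabs_pos u).
  assert (E : u ^ 2 = Rabs u ^ 2) by (rewrite pow2_abs; reflexivity).
  assert (Hu2 : - Rabs u <= u <= Rabs u)
    by (apply Rabs_le_between, Rle_refl).
  rewrite E in Hy.
  set (T := Rabs u) in *.
  apply Rabs_le_between in Hy.
  assert (Hw2 : 0 < w ^ 2) by (apply pow_lt; lra).
  assert (Hw2' : w ^ 2 <= 875 / 100000 * w)
    by (simpl; rewrite Rmult_1_r; apply Rmult_le_compat_r; lra).
  assert (Hwu : - (w ^ 2 * T) <= w ^ 2 * u <= w ^ 2 * T) by nra.
  assert (HT : T <= 51 / 100 * w) by lra.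
  split.
  - assert (HTw : 0 <= T + w ^ 2 <= 52 / 100 * w) by nra.
    assert (H1 : T * (T + w ^ 2) ^ 2 <= (51 / 100 * w) * (52 / 100 * w) ^ 2).
    { apply Rmult_le_compat; try lra; [nra|apply pow_incr; lra]. }
    assert (H2 : T ^ 2 <= (w / 2 * (1 + w)) ^ 2) by (apply pow_incr; lra).
    assert (H3 : w ^ 2 * T <= w ^ 2 * (51 / 100 * w)) by nra.
    assert (0 < w ^ 3) by (apply pow_lt; lra).
    assert (w ^ 4 <= w ^ 3) by nra.
    nra.
  - set (A := 2 - 51 / 10 * w - 20 * w ^ 2).
    set (B := w ^ 2 * (1 + 5 * w ^ 2)).
    set (C := w ^ 4 / 2 * (1 + 60 * w)).
    assert (HA : 0 < A) by (unfold A; nra).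
    assert (H1 : y <= - A * T ^ 2 + 2 * B * T).
    { assert (T * T ^ 2 <= 51 / 100 * w * T ^ 2)
        by (apply Rmult_le_compat_r; [nra|lra]).
      unfold A, B; nra. }
    (* The discriminant of the quadratic polynomial [A T ^ 2 - 2 B T + C] is not
       positive. *)
    assert (HAC : B ^ 2 <= A * C).
    { unfold A, B, C.
      replace ((w ^ 2 * (1 + 5 * w ^ 2)) ^ 2)
        with (w ^ 4 * (1 + 5 * w ^ 2) ^ 2) by ring.
      replace ((2 - 51 / 10 * w - 20 * w ^ 2) * (w ^ 4 / 2 * (1 + 60 * w)))
        with (w ^ 4 * ((1 - 51 / 20 * w - 10 * w ^ 2) * (1 + 60 * w))) by field.
      apply Rmult_le_compat_l; [apply pow_le; lra|].
      assert (w ^ 2 <= w * (1 / 100)) by nra.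
      assert (0 < w ^ 2 <= 1) by nra.
      assert (w ^ 3 <= w ^ 2) by nra.
      assert (w ^ 4 <= w ^ 2) by nra.
      nra. }
    apply Rmult_le_reg_l with A; [exact HA|].
    assert (0 <= (A * T - B) ^ 2) by apply pow2_ge_0.
    nra.
Qed.

(** Bounds that are polynomial in [w]. The number 11 comes from
    [1 + 25 w <= sqrt (1 + 571 / 10 * w)], half of the slope 25 being available
    after the quadratic term of the left end is subtracted. *)
Lemma box_sufficient (w x y : R) :
  0 < w <= 875 / 100000 ->
  Rabs x <= w / 2 + 11 * w ^ 2 ->
  - (w ^ 2 / 2) * (1 + 57 * w) <= y <= w ^ 4 / 2 * (1 + 60 * w) ->
  box (w ^ 2) (571 / 10 * w) (619 / 10 * w) (x, y).
Proof.
  intros Hw Hx Hy; apply Rabs_le_between in Hx.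
  assert (Hw2 : 0 < w ^ 2) by (apply pow_lt; lra).
  assert (Hww : w ^ 2 <= 875 / 100000 * w)
    by (simpl; rewrite Rmult_1_r; apply Rmult_le_compat_r; lra).
  assert (Hww3 : w * w ^ 2 <= 875 / 100000 * w ^ 2)
    by (apply Rmult_le_compat_r; lra).
  unfold box; simpl fst; simpl snd.
  assert (Hs : 1 + 25 * w <= sqrt (1 + 571 / 10 * w)).
  { apply Rsqr_incr_0_var; [|apply sqrt_pos].
    rewrite Rsqr_sqrt by lra; unfold Rsqr; nra. }
  assert (Hsw : (1 + 25 * w) * w <= sqrt (1 + 571 / 10 * w) * w)
    by (apply Rmult_le_compat_r; lra).
  assert (Hu := lam_u_plus_bound (w ^ 2) (619 / 10 * w) ltac:(lra) ltac:(lra)).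
  simpl in Hu.
  split; split.
  - unfold lam_c_minus; rewrite sqrt_pow2 by lra. nra.
  - unfold lam_c_plus; rewrite sqrt_pow2 by lra. nra.
  - unfold lam_u_minus.
    set (rt := sqrt _).
    assert (0 <= rt) by apply sqrt_pos.
    assert (0 <= w ^ 2 * (w * rt)) by (apply Rmult_le_pos; nra).
    nra.
  - apply Rle_trans with (2 := Hu); apply Rle_trans with (1 := proj2 Hy).
    replace (w * (w * 1)) with (w ^ 2) by ring.
    replace ((1 + 619 / 10 * w) * w ^ 2 * ((1 + 619 / 10 * w) * w ^ 2 * 1) / 2 *
             (1 - 2 * ((1 + 619 / 10 * w) * w ^ 2)))
      with (w ^ 4 / 2 * ((1 + 619 / 10 * w) ^ 2
            * (1 - 2 * (1 + 619 / 10 * w) * w ^ 2))) by field.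
    apply Rmult_le_compat_l; [apply Rmult_le_pos; [apply pow_le; lra|lra]|].
    assert (H1 : 1 + 1238 / 10 * w <= (1 + 619 / 10 * w) ^ 2) by nra.
    assert (H2 : 1 - w <= 1 - 2 * (1 + 619 / 10 * w) * w ^ 2) by nra.
    apply Rle_trans with ((1 + 1238 / 10 * w) * (1 - w)); [nra|].
    apply Rmult_le_compat; lra.
Qed.

Lemma sum_root_bounds (lam v : R) :
  0 <= lam <= 1 -> 0 <= v -> lam * (v + 3) = v ^ 3 + 6 * v ^ 2 + 12 * v ->
  lam / 4 - lam ^ 2 / 20 <= v <= lam / 4.
Proof.
  intros Hl Hv H.
  assert (H4 : v <= lam / 4).
  { apply Rmult_le_reg_r with (v + 3); [lra|].
    assert (0 <= v ^ 3) by (apply pow_le; lra). nra. }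
  split; [|exact H4].
  assert (H0 : v * (12 + 6 * v + v ^ 2) >= 3 * lam) by nra.
  assert (H1 : 12 + 6 * v + v ^ 2 <= 12 + 2 * lam) by nra.
  nra.
Qed.

(** The sum of the cycle is [- lam / 4] and its gap [sqrt lam], both up to
    relative errors of order [lam]. *)
Lemma small_two_cycle (w : R) :
  0 < w <= 875 / 100000 ->
  exists a b,
    two_cycle (w ^ 2) a b /\ a + b <= 0 /\
    b < 0 /\ - (96 / 100) * b <= a <= - (104 / 100) * b /\
    Rabs a <= w / 2 * (1 + w) /\ Rabs b <= w / 2 * (1 + w) /\
    Rabs (- 2 * b - a) <= w / 2 + 11 * w ^ 2 /\
    Rabs (- 2 * a - b) <= w / 2 + 11 * w ^ 2 /\
    - (w ^ 2 / 2) * (1 + 57 * w) <= 2 * a + 2 * b <= w ^ 4 / 2 * (1 + 60 * w).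
Proof.
  intros Hw.
  assert (Hw2 : 0 < w ^ 2) by (apply pow_lt; lra).
  assert (Hww : w ^ 2 <= 875 / 100000 * w)
    by (simpl; rewrite Rmult_1_r; apply Rmult_le_compat_r; lra).
  destruct (ex_sum_root (w ^ 2) ltac:(lra)) as (v & Hv & Hr).
  assert (Hb := sum_root_bounds (w ^ 2) v ltac:(lra) Hv Hr).
  assert (Hvv : v ^ 2 <= v * (w ^ 2)) by nra.
  set (D := 4 * w ^ 2 - 3 * v ^ 2 - 12 * v).
  assert (HD : (97 / 100 * w) ^ 2 <= D <= (w + w ^ 2 / 10) ^ 2).
  { unfold D; split.
    - assert (v * w ^ 2 <= 1 / 1000 * w ^ 2) by (apply Rmult_le_compat_r; lra). nra.
    - assert ((w ^ 2) ^ 2 <= w ^ 2 * (1 / 100 * w))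
        by (replace ((w ^ 2) ^ 2) with (w ^ 2 * w ^ 2) by ring;
            apply Rmult_le_compat_l; lra).
      nra. }
  assert (HDp : 0 < (97 / 100 * w) ^ 2) by (apply pow_lt; lra).
  set (d := sqrt D).
  assert (Hd : d ^ 2 = D) by (apply pow2_sqrt; lra).
  assert (Hd0 : 97 / 100 * w <= d <= w + w ^ 2 / 10).
  { unfold d; split.
    - rewrite <- (sqrt_pow2 (97 / 100 * w)) by lra; apply sqrt_le_1; lra.
    - rewrite <- (sqrt_pow2 (w + w ^ 2 / 10)) by lra; apply sqrt_le_1; lra. }
  exists ((- v + d) / 2), ((- v - d) / 2).
  split; [apply two_cycle_param; [lra | exact Hd | lra]|].
  assert (0 < w ^ 4) by (apply pow_lt; lra).
  repeat split; try lra; try (apply Rabs_le; lra).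
  - nra.
  - apply Rle_trans with 0; [lra|]. apply Rmult_le_pos; lra.
Qed.

(** The coordinate [x = - 2 v - u] is increasing for the order of the cone, so
    it stays between 0 and its value at the cycle; the height is controlled by the
    parabola. *)
Lemma branch_in_box (w r a b : R) (s : R -> R) (z : R * R) :
  0 < w <= 875 / 100000 -> connecting_branch (w ^ 2) r a b s ->
  Rabs a <= w / 2 * (1 + w) -> Rabs b <= w / 2 * (1 + w) ->
  Rabs (- 2 * b - a) <= w / 2 + 11 * w ^ 2 ->
  Rabs (- 2 * a - b) <= w / 2 + 11 * w ^ 2 ->
  branch_set r s z -> box (w ^ 2) (571 / 10 * w) (619 / 10 * w) z.
Proof.
  intros Hw CB Ha Hb Hx1 Hx2 (t & Ht & ->).
  assert (Hr := cb_rate _ _ _ _ _ CB).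
  assert (Hback : - / r * (- r * t) = t) by (field; lra).
  assert (Hg := cb_graph _ _ _ _ _ CB t Ht).
  assert (HB : (0 < t /\ between_cycle s r 1 a b t /\
                between_cycle s r (- 1) b a (- r * t)) \/
               (t < 0 /\ between_cycle s r (- 1) b a t /\
                between_cycle s r 1 a b (- r * t))).
  { destruct (Rtotal_order t 0) as [Hn|[E|Hp]]; [right|contradiction|left].
    - split; [exact Hn|split; [apply CB, Hn|apply CB; nra]].
    - split; [exact Hp|split; [apply CB, Hp|apply CB; nra]]. }
  unfold between_cycle in HB; rewrite Hback in HB.
  assert (Hu : Rabs (s t) <= w / 2 * (1 + w)).
  { destruct HB as [(_ & [C1 C2] & _)|(_ & [C1 C2] & _)].
    - apply Rle_trans with (2 := Ha).
      apply (cone_bounds _ _ _ _ _ (or_introl eq_refl) C1 C2).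
    - apply Rle_trans with (2 := Hb).
      apply (cone_bounds _ _ _ _ _ (or_intror eq_refl) C1 C2). }
  unfold branch_point, state; apply box_sufficient; [exact Hw| |].
  - apply Rabs_le_between in Hx1; apply Rabs_le_between in Hx2; apply Rabs_le.
    unfold cone in HB.
    destruct HB as [(_ & _ & C1 & C2)|(_ & _ & C1 & C2)]; lra.
  - apply (height_bound w (s t)); [exact Hw|exact Hu|].
    unfold near_graph, graph_defect in Hg; rewrite Rmult_plus_distr_l in Hg; exact Hg.
Qed.

(** * Bifurcation, two-cycle and heteroclinic connections *)

Theorem theorem4p5 :
  period_doubling F 0 (0, 0) /\
  (exists q : R -> R * R, bifurcating_orbit F 0 (0, 0) (76 / 10 ^ 6) q) /\
  (forall q : R -> R * R, bifurcating_orbit F 0 (0, 0) (76 / 10 ^ 6) q ->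
   forall lam : R, 0 < lam <= (76 / 10 ^ 6) ->
     let B := box lam (571 / 10 * sqrt lam) (619 / 10 * sqrt lam) in
     let P := orbit_of_two (F lam) (q lam) in
     (forall z : R * R, P z -> B z) /\
     (exists M : R * R -> Prop,
        one_dim_manifold M /\
        (exists z : R * R, M z) /\
        (forall z : R * R, M z -> B z) /\
        (forall z : R * R, M z ->
           exists u : Z -> R * R,
             u 0%Z = z /\
             (forall n : Z, M (u n)) /\
             heteroclinic (F lam) (fun w => w = (0, 0)) P u))).
Proof.
  split; [exact period_doubling_F|].
  split; [apply bifurcating_orbit_exists|].
  intros q (_ & _ & Hq) lam Hlam B P.
  specialize (Hq lam Hlam).
  set (w := sqrt lam) in *.
  assert (Hw0 : 0 < w) by (apply sqrt_lt_R0; lra).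
  assert (El : lam = w ^ 2) by (symmetry; apply pow2_sqrt; lra).
  assert (Hw : 0 < w <= 875 / 100000).
  { split; [exact Hw0|]; apply Rnot_lt_le; intros H.
    assert (H2 : 875 / 100000 * (875 / 100000) < w * w)
      by (apply Rmult_le_0_lt_compat; lra).
    lra. }
  unfold B; clear B; clearbody w; subst lam.
  assert (Hw1 : w ^ 2 <= 1) by lra.
  destruct (small_two_cycle w Hw)
    as (a & b & Hc & Hs & Hb0 & Hab & Ha & Hb & X1 & X2 & Y).
  assert (Hc' := two_cycle_sym _ _ _ Hc).
  assert (Fab : F (w ^ 2) (state a b) = state b a).
  { rewrite F_state, (proj1 (proj2 Hc)); f_equal; ring. }
  assert (Fba : F (w ^ 2) (state b a) = state a b).
  { rewrite F_state, (proj1 (proj2 Hc')); f_equal; ring. }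
  assert (Hqz : (q (w ^ 2) = state a b \/ q (w ^ 2) = state b a)).
  { rewrite (state_surj (q (w ^ 2))) in Hq |- *; apply period_two_state in Hq.
    destruct (two_cycle_unique _ _ _ _ _ Hw1 Hs Hc Hq) as [[-> ->]|[-> ->]];
      auto. }
  assert (HP : P (state a b) /\ P (state b a) /\
               forall z, P z -> z = state a b \/ z = state b a).
  { unfold P, orbit_of_two; destruct Hqz as [-> | ->]; rewrite ?Fab, ?Fba; tauto. }
  destruct HP as (P1 & P2 & P3).
  split.
  { intros z Hz; destruct (P3 z Hz) as [-> | ->]; unfold state; apply box_sufficient;
      try assumption; lra. }
  destruct (connecting_branch_exists (w ^ 2) a b) as (r & s & CB);
    try assumption; try nra.
  exists (branch_set r s).
  split; [apply (branch_manifold _ _ _ _ _ CB)|].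
  split; [exists (branch_point r s 1), 1; split; [lra|reflexivity]|].
  split; [intros z Hz; apply (branch_in_box w r a b s); assumption|].
  intros z (t & Ht & ->); apply (branch_heteroclinic _ _ a b); assumption.
Qed.
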